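(* Full quadratic proper biharmonic maps of $\mathbb{S}^3$ into $\mathbb{S}^n$ exist only if $3\le n\le 9$ and $n\ne 4$. Moreover, if $\varphi:\mathbb{S}^3\to\mathbb{S}^n$ is a full proper biharmonic quadratic form, then there exist $U\in O(4)$, $V\in O(n+1)$ and a symmetric positive definite $n\times n$ real matrix $B$ such that $$V\circ\varphi\circ U=\left(\frac{1}{\sqrt2}\,B\circ\varphi_{n-1},\ \frac{1}{\sqrt2}\right),$$ where, for $k\in\{2,4,5,6,7,8\}$, the map $\varphi_k:\mathbb{S}^3\to\mathbb{S}^k\subset\mathbb{R}^{k+1}$ is defined, with $\overline x=(x^1,x^2,x^3,x^4)$, by $$\varphi_2(\overline x)=\left((x^1)^2+(x^2)^2-(x^3)^2-(x^4)^2,\ 2(x^1x^3-x^2x^4),\ 2(x^1x^4+x^2x^3)\right),$$ $$\varphi_4(\overline x)=\left((x^1)^2+(x^2)^2-(x^3)^2-(x^4)^2,\ 2x^1x^3,\ 2x^1x^4,\ 2x^2x^3,\ 2x^2x^4\right),$$ $$\varphi_5(\overline x)=\left((x^1)^2-(x^2)^2,\ (x^3)^2-(x^4)^2,\ 2x^1x^2,\ \sqrt2(x^1x^3+x^2x^4),\ \sqrt2(x^2x^3-x^1x^4),\ 2x^3x^4\right),$$ $$\varphi_6(\overline x)=\Big(\tfrac{1}{\sqrt2}\big((x^1)^2+(x^2)^2-(x^3)^2-(x^4)^2\big),\ \tfrac{1}{\sqrt2}\big((x^1)^2-(x^2)^2\big),\ \tfrac{1}{\sqrt2}\big((x^3)^2-(x^4)^2\big),\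 \sqrt2x^1x^2,\ \sqrt3(x^1x^3+x^2x^4),\ \sqrt3(x^2x^3-x^1x^4),\ \sqrt2x^3x^4\Big),$$ $$\varphi_7(\overline x)=\left((x^1)^2-(x^2)^2,\ (x^3)^2-(x^4)^2,\ 2x^1x^2,\ \sqrt2x^1x^3,\ \sqrt2x^1x^4,\ \sqrt2x^2x^3,\ \sqrt2x^2x^4,\ 2x^3x^4\right),$$ and $\varphi_8=\varphi_{\lambda_2}:\mathbb{S}^3\to\mathbb{S}^8$ is a standard minimal immersion.
   Context: $\mathbb{S}^k$ denotes the unit Euclidean sphere in $\mathbb{R}^{k+1}$ with its standard metric. A quadratic form (quadratic map) $\varphi:\mathbb{S}^m\to\mathbb{S}^n$ is the restriction to $\mathbb{S}^m$ of a map $F:\mathbb{R}^{m+1}\to\mathbb{R}^{n+1}$ all of whose components are homogeneous polynomials of degree $2$ and which satisfies $|F(\overline x)|=1$ whenever $|\overline x|=1$; quadratic forms are assumed non-constant. A map into $\mathbb{S}^n$ is full if its image is not contained in any totally geodesic hypersphere of $\mathbb{S}^n$ (i.e. in any linear hyperplane of $\mathbb{R}^{n+1}$). A standard minimal immersion $\varphi_{\lambda_2}:\mathbb{S}^3\to\mathbb{S}^8$ is a map whose nine components form an orthogonal basis, with all elements of equal $L^2(\mathbb{S}^3)$-norm, of the $9$-dimensional space of restrictions to $\mathbb{S}^3$ of harmonic homogeneous quadratic polynomials on $\mathbb{R}^4$, scaled so that the map takes values in the unit sphere. Matrices act linearly on vectors, so $(B\circ\varphi_{n-1})(\overline x)=B\,\varphi_{n-1}(\overline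 x)\in\mathbb{R}^n$. The tension field of a smooth map $\varphi:(M,g)\to(N,h)$ is $\tau(\varphi)=\mathrm{trace}\,\nabla d\varphi$; $\varphi$ is harmonic if $\tau(\varphi)=0$. For $M$ compact, $\varphi$ is biharmonic if it is a critical point of the bienergy $E_2(\varphi)=\frac12\int_M|\tau(\varphi)|^2\,v_g$; equivalently, $\tau_2(\varphi)=-\Delta\tau(\varphi)-\mathrm{trace}\,R^N(d\varphi(\cdot),\tau(\varphi))d\varphi(\cdot)=0$, where $\Delta\sigma=-\mathrm{trace}\,\nabla^2\sigma$ and $R(X,Y)Z=\nabla_X\nabla_YZ-\nabla_Y\nabla_XZ-\nabla_{[X,Y]}Z$. A map is proper biharmonic if it is biharmonic but not harmonic. *)

(* Defs.v *)
From mathcomp Require Import all_boot all_order all_algebra.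
From mathcomp Require Import all_classical all_reals all_analysis.

Set Implicit Arguments.
Unset Strict Implicit.
Unset Printing Implicit Defensive.

Import Order.TTheory GRing.Theory Num.Theory.
Import numFieldNormedType.Exports.

Local Open Scope classical_set_scope.
Local Open Scope ring_scope.

Section Euclidean.
Variable R : realType.

Definition dotv k (u v : 'cV[R]_k) : R := \sum_i u i 0 * v i 0.

(* The norm that the library puts on matrices is the sup norm. *)
Definition enorm k (u : 'cV[R]_k) : R := Num.sqrt (dotv u u).

(* [usphere k] is the unit sphere of R^k, of dimension k - 1.  A map between
   spheres is represented by a function of the ambient spaces; nothing below
   depends on its values off the sphere. *)
Definition usphere k : set 'cV[R]_k := [set x | enorm x = 1].
Arguments usphere : clear implicits.

Definition orthogonal_mx k (A : 'M[R]_k) : Prop := A *m A^T = 1%:M.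

Definition sympos_mx k (B : 'M[R]_k) : Prop :=
  B^T = B /\ forall v : 'cV[R]_k, v != 0 -> 0 < dotv v (B *m v).

Definition maps_sphere p q (phi : 'cV[R]_p -> 'cV[R]_q) : Prop :=
  forall x, x \in usphere p -> phi x \in usphere q.

Definition homogeneous2 p (f : 'cV[R]_p -> R) : Prop :=
  exists A : 'M[R]_p,
    forall x, f x = \sum_i \sum_j A i j * x i 0 * x j 0.

Definition quadratic_form p q (phi : 'cV[R]_p -> 'cV[R]_q) : Prop :=
  (exists F : 'cV[R]_p -> 'cV[R]_q,
     [/\ forall i : 'I_q, homogeneous2 (fun x => F x i 0),
         maps_sphere F
       & forall x, x \in usphere p -> phi x = F x])
  /\ (exists x y, [/\ x \in usphere p, y \in usphere p & phi x != phi y]).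

Definition full_map p q (phi : 'cV[R]_p -> 'cV[R]_q) : Prop :=
  ~ exists2 c : 'cV[R]_q, c != 0 &
      forall x, x \in usphere p -> dotv c (phi x) = 0.

End Euclidean.

Arguments usphere : clear implicits.

Section SphereGeometry.
Variable R : realType.

Definition normalize k (x : 'cV[R]_k) : 'cV[R]_k := (enorm x)^-1 *: x.

Definition tangent_part k (y v : 'cV[R]_k) : 'cV[R]_k := v - dotv v y *: y.

(* Derivative at the point x of the sphere, in the tangent direction v, of a
   map given on the sphere: the map is extended off the sphere by
   homogeneity of degree 0 (any smooth extension gives the same value). *)
Definition sderive p q (s : 'cV[R]_p -> 'cV[R]_q) (x v : 'cV[R]_p)
  : 'cV[R]_q := 'D_v (s \o @normalize p) x.

(* Vector fields X, Y on the sphere are tangent fields 'cV_p -> 'cV_p, and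
   sections s of phi^-1 (T usphere q) are functions 'cV_p -> 'cV_q with
   dotv (s x) (phi x) = 0. *)

(* The pull-back by phi of the Levi-Civita connection of the target sphere,
   which is the tangential part of the flat connection. *)
Definition pullback_conn p q (phi : 'cV[R]_p -> 'cV[R]_q)
    (X : 'cV[R]_p -> 'cV[R]_p) (s : 'cV[R]_p -> 'cV[R]_q)
  : 'cV[R]_p -> 'cV[R]_q :=
  fun x => tangent_part (phi x) (sderive s x (X x)).

Definition levi_civita p (X Y : 'cV[R]_p -> 'cV[R]_p)
  : 'cV[R]_p -> 'cV[R]_p := pullback_conn id X Y.

Definition lie_bracket p (X Y : 'cV[R]_p -> 'cV[R]_p)
  : 'cV[R]_p -> 'cV[R]_p :=
  fun x => sderive Y x (X x) - sderive X x (Y x).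

(* The tangent field that extends v, for v tangent at some point. *)
Definition tangent_field p (v : 'cV[R]_p) : 'cV[R]_p -> 'cV[R]_p :=
  fun x => tangent_part x v.

(* R(u, v) w at y, with the sign convention
   R(X, Y) Z = D_X D_Y Z - D_Y D_X Z - D_[X, Y] Z; it is tensorial, so any
   tangent fields that extend u, v and w may be used. *)
Definition curvature k (y u v w : 'cV[R]_k) : 'cV[R]_k :=
  let X := tangent_field u in
  let Y := tangent_field v in
  let Z := tangent_field w in
  levi_civita X (levi_civita Y Z) y - levi_civita Y (levi_civita X Z) y
  - levi_civita (lie_bracket X Y) Z y.

Definition differential p q (phi : 'cV[R]_p -> 'cV[R]_q)
    (X : 'cV[R]_p -> 'cV[R]_p) : 'cV[R]_p -> 'cV[R]_q :=
  fun x => sderive phi x (X x).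

(* (nabla d phi)(X, Y) *)
Definition second_fundamental_form p q (phi : 'cV[R]_p -> 'cV[R]_q)
    (X Y : 'cV[R]_p -> 'cV[R]_p) : 'cV[R]_p -> 'cV[R]_q :=
  fun x => pullback_conn phi X (differential phi Y) x
           - differential phi (levi_civita X Y) x.

(* (nabla^2 s)(X, Y) *)
Definition second_covariant p q (phi : 'cV[R]_p -> 'cV[R]_q)
    (s : 'cV[R]_p -> 'cV[R]_q) (X Y : 'cV[R]_p -> 'cV[R]_p)
  : 'cV[R]_p -> 'cV[R]_q :=
  fun x => pullback_conn phi X (pullback_conn phi Y s) x
           - pullback_conn phi (levi_civita X Y) s x.

(* The tangential parts P e_a of the canonical basis of R^p satisfy
   \sum_a (P e_a) (P e_a)^T = P = \sum_i u_i u_i^T for every orthonormal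
   basis (u_i) of the tangent space, so that the trace of a bilinear form b
   on the tangent space is \sum_a b (P e_a) (P e_a). *)
Definition frame p (a : 'I_p) : 'cV[R]_p -> 'cV[R]_p :=
  tangent_field (delta_mx a 0).

Definition trace_tangent p q
    (b : ('cV[R]_p -> 'cV[R]_p) -> ('cV[R]_p -> 'cV[R]_p) ->
         'cV[R]_p -> 'cV[R]_q) : 'cV[R]_p -> 'cV[R]_q :=
  fun x => \sum_(a < p) b (frame a) (frame a) x.

Definition tension p q (phi : 'cV[R]_p -> 'cV[R]_q) : 'cV[R]_p -> 'cV[R]_q :=
  trace_tangent (second_fundamental_form phi).

Definition rough_laplacian p q (phi : 'cV[R]_p -> 'cV[R]_q)
    (s : 'cV[R]_p -> 'cV[R]_q) : 'cV[R]_p -> 'cV[R]_q :=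
  fun x => - trace_tangent (second_covariant phi s) x.

Definition bitension p q (phi : 'cV[R]_p -> 'cV[R]_q)
  : 'cV[R]_p -> 'cV[R]_q :=
  fun x =>
    - rough_laplacian phi (tension phi) x
    - trace_tangent
        (fun X Y z => curvature (phi z) (differential phi X z)
                        (tension phi z) (differential phi Y z)) x.

(* These are the usual notions for maps phi that are smooth on the sphere,
   in particular for quadratic forms. *)
Definition harmonic_map p q (phi : 'cV[R]_p -> 'cV[R]_q) : Prop :=
  forall x, x \in usphere R p -> tension phi x = 0.

Definition biharmonic_map p q (phi : 'cV[R]_p -> 'cV[R]_q) : Prop :=
  forall x, x \in usphere R p -> bitension phi x = 0.

Definition proper_biharmonic p q (phi : 'cV[R]_p -> 'cV[R]_q) : Prop :=
  biharmonic_map phi /\ ~ harmonic_map phi.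

End SphereGeometry.

Section StandardMinimalImmersion.
Variable R : realType.

Definition col_of n (s : seq R) : 'cV[R]_n := \col_(i < n) s`_i.

Definition spherical_coord (t1 t2 t3 : R) : 'cV[R]_4 :=
  col_of 4 [:: cos t1;
               sin t1 * cos t2;
               sin t1 * sin t2 * cos t3;
               sin t1 * sin t2 * sin t3].

(* Integral over the unit sphere of R^4, in spherical coordinates. *)
Definition integral_S3 (f : 'cV[R]_4 -> R) : R :=
  \int[lebesgue_measure]_(t1 in `[0, pi])
   \int[lebesgue_measure]_(t2 in `[0, pi])
    \int[lebesgue_measure]_(t3 in `[0, 2 * pi])
      (f (spherical_coord t1 t2 t3) * (sin t1 ^+ 2 * sin t2)).

Definition L2_S3 (f g : 'cV[R]_4 -> R) : R :=
  integral_S3 (fun x => f x * g x).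

Definition laplacian p (f : 'cV[R]_p -> R) : 'cV[R]_p -> R :=
  fun x => \sum_(i < p)
    'D_(delta_mx i 0) (fun y => 'D_(delta_mx i 0) f y) x.

(* Membership in the space of restrictions to the sphere of harmonic
   homogeneous quadratic polynomials. *)
Definition quadratic_harmonic p (f : 'cV[R]_p -> R) : Prop :=
  exists h : 'cV[R]_p -> R,
    [/\ homogeneous2 h,
        forall x, laplacian h x = 0
      & forall x, x \in usphere R p -> f x = h x].

Definition standard_minimal_immersion (phi : 'cV[R]_4 -> 'cV[R]_9) : Prop :=
  let comp (i : 'I_9) := fun x => phi x i 0 in
  [/\ maps_sphere phi,
      forall i, quadratic_harmonic (comp i),
      (forall h, quadratic_harmonic h ->
         exists c : 'cV[R]_9, forall x, x \in usphere R 4 ->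
           h x = dotv c (phi x))
      /\ (forall c : 'cV[R]_9,
            (forall x, x \in usphere R 4 -> dotv c (phi x) = 0) -> c = 0),
      forall i j, i != j -> L2_S3 (comp i) (comp j) = 0
    & forall i j, L2_S3 (comp i) (comp i) = L2_S3 (comp j) (comp j)].

End StandardMinimalImmersion.

Section Models.
Variable R : realType.
Local Notation sqrt2 := (Num.sqrt (2 : R)).
Local Notation sqrt3 := (Num.sqrt (3 : R)).

Definition crd (x : 'cV[R]_4) (k : nat) : R := x (inord k) 0.

Definition phi2 (x : 'cV[R]_4) : 'cV[R]_3 :=
  let x1 := crd x 0 in let x2 := crd x 1 in
  let x3 := crd x 2 in let x4 := crd x 3 in
  col_of 3 [:: x1 ^+ 2 + x2 ^+ 2 - x3 ^+ 2 - x4 ^+ 2;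
               2 * (x1 * x3 - x2 * x4);
               2 * (x1 * x4 + x2 * x3)].

Definition phi4 (x : 'cV[R]_4) : 'cV[R]_5 :=
  let x1 := crd x 0 in let x2 := crd x 1 in
  let x3 := crd x 2 in let x4 := crd x 3 in
  col_of 5 [:: x1 ^+ 2 + x2 ^+ 2 - x3 ^+ 2 - x4 ^+ 2;
               2 * x1 * x3;
               2 * x1 * x4;
               2 * x2 * x3;
               2 * x2 * x4].

Definition phi5 (x : 'cV[R]_4) : 'cV[R]_6 :=
  let x1 := crd x 0 in let x2 := crd x 1 in
  let x3 := crd x 2 in let x4 := crd x 3 in
  col_of 6 [:: x1 ^+ 2 - x2 ^+ 2;
               x3 ^+ 2 - x4 ^+ 2;
               2 * x1 * x2;
               sqrt2 * (x1 * x3 + x2 * x4);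
               sqrt2 * (x2 * x3 - x1 * x4);
               2 * x3 * x4].

Definition phi6 (x : 'cV[R]_4) : 'cV[R]_7 :=
  let x1 := crd x 0 in let x2 := crd x 1 in
  let x3 := crd x 2 in let x4 := crd x 3 in
  col_of 7 [:: sqrt2^-1 * (x1 ^+ 2 + x2 ^+ 2 - x3 ^+ 2 - x4 ^+ 2);
               sqrt2^-1 * (x1 ^+ 2 - x2 ^+ 2);
               sqrt2^-1 * (x3 ^+ 2 - x4 ^+ 2);
               sqrt2 * x1 * x2;
               sqrt3 * (x1 * x3 + x2 * x4);
               sqrt3 * (x2 * x3 - x1 * x4);
               sqrt2 * x3 * x4].

Definition phi7 (x : 'cV[R]_4) : 'cV[R]_8 :=
  let x1 := crd x 0 in let x2 := crd x 1 in
  let x3 := crd x 2 in let x4 := crd x 3 in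
  col_of 8 [:: x1 ^+ 2 - x2 ^+ 2;
               x3 ^+ 2 - x4 ^+ 2;
               2 * x1 * x2;
               sqrt2 * x1 * x3;
               sqrt2 * x1 * x4;
               sqrt2 * x2 * x3;
               sqrt2 * x2 * x4;
               2 * x3 * x4].

(* [is_phi_pred n f]: f is the map phi_(n-1) into R^n.  For n = 9 this is any
   standard minimal immersion, as these are only defined up to an
   orthogonal transformation of R^9. *)
Definition is_phi_pred (n : nat) : ('cV[R]_4 -> 'cV[R]_n) -> Prop :=
  match n with
  | 3 => fun f => f = phi2
  | 5 => fun f => f = phi4
  | 6 => fun f => f = phi5
  | 7 => fun f => f = phi6
  | 8 => fun f => f = phi7
  | 9 => fun f => standard_minimal_immersion f
  | _ => fun _ => False
  end.

End Models.

(* Main.v *)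
Require Import Defs.
From mathcomp Require Import all_boot all_order all_algebra.
From mathcomp Require Import fingroup perm spectral complex.
From mathcomp Require Import all_classical all_reals all_analysis.
From mathcomp Require Import ring lra.

(** Write F = (x^T A_i x)_i for the quadratic map extending phi, T for the
    vector of traces of the A_i, f = <T, F>, and M for the matrix of f.  On the
    sphere the tension field is twice the tangential part of T along F, and
    pairing the bitension field with T yields
      2 (|M x|^2 - f^2) = (2 - f) (|T|^2 - f^2).
    Restricted to a plane spanned by orthonormal vectors this is an identity of
    binary sextics which, modulo 1 + t^2, says g^3 = 0 for the restriction g of
    f; hence f is constant on every great circle and M = mu I.  As
    |T|^2 = 4 mu, mu is 0, 2 or 4; 0 gives a harmonic map and 4 a constant one.
    With mu = 2 and c = T / 4, phi = psi + c where |c|^2 = |psi|^2 = 1/2, psi is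
    orthogonal to c and has harmonic quadratic components.

    A harmonic quadratic form on R^4 is x |-> <X, rho x> for a unique 3x3
    matrix X, rho x being the quaternionic rotation matrix of x.  If psi is
    given by the family X_k, then Y |-> sum_k <X_k, Y>^2 is constant on SO(3),
    so it has the form tr (P Y Y^T) + tr (Q Y^T Y).  Rotating both sides, which
    is done by an element of SO(4), makes P and Q diagonal; the (a, b) entries
    of the X_k then form pairwise orthogonal vectors of squared norm
    p_a + q_b >= 0, and by fullness n is the number of nonzero ones.  Those
    that vanish form a rectangle argmin p x argmin q, so
    n = 9 - i j with i j in {0, 1, 2, 3, 4, 6}.  For each n the rectangle is
    determined up to permutation and transposition, and so is the span of the
    components of psi; a polar decomposition concludes. *)

Set Implicit Arguments.
Unset Strict Implicit.
Unset Printing Implicit Defensive.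

Import Order.TTheory GRing.Theory Num.Theory.
Import numFieldNormedType.Exports.
Local Open Scope classical_set_scope.
Local Open Scope ring_scope.

(** * Maps on the sphere and their derivatives *)

Section Dot.
Variable R : realType.

Lemma dotvE k (u v : 'cV[R]_k) : dotv u v = (u^T *m v) 0 0.
Proof. by rewrite mxE; apply: eq_bigr => i _; rewrite mxE. Qed.

Lemma dotvC k (u v : 'cV[R]_k) : dotv u v = dotv v u.
Proof. by apply: eq_bigr => i _; rewrite mulrC. Qed.

Lemma dotvDl k (u v w : 'cV[R]_k) : dotv (u + v) w = dotv u w + dotv v w.
Proof. by rewrite !dotvE linearD mulmxDl mxE. Qed.

Lemma dotvDr k (u v w : 'cV[R]_k) : dotv u (v + w) = dotv u v + dotv u w.
Proof. by rewrite !dotvE mulmxDr mxE. Qed.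

Lemma dotvNl k (u v : 'cV[R]_k) : dotv (- u) v = - dotv u v.
Proof. by rewrite !dotvE linearN mulNmx mxE. Qed.

Lemma dotvNr k (u v : 'cV[R]_k) : dotv u (- v) = - dotv u v.
Proof. by rewrite !dotvE mulmxN mxE. Qed.

Lemma dotvZl k a (u v : 'cV[R]_k) : dotv (a *: u) v = a * dotv u v.
Proof. by rewrite !dotvE linearZ /= -scalemxAl mxE. Qed.

Lemma dotvZr k a (u v : 'cV[R]_k) : dotv u (a *: v) = a * dotv u v.
Proof. by rewrite !dotvE -scalemxAr mxE. Qed.

Lemma dot0v k (v : 'cV[R]_k) : dotv 0 v = 0.
Proof. by rewrite -[0](scale0r v) dotvZl mul0r. Qed.

Lemma dotv0 k (v : 'cV[R]_k) : dotv v 0 = 0.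
Proof. by rewrite dotvC dot0v. Qed.

Definition dotv_linE := (dotvDl, dotvDr, dotvNl, dotvNr, dotvZl, dotvZr).

Lemma dotv_sumr k (I : finType) (u : 'cV[R]_k) (F : I -> 'cV[R]_k) :
  dotv u (\sum_a F a) = \sum_a dotv u (F a).
Proof. by rewrite dotvE mulmx_sumr summxE; apply: eq_bigr => a _; rewrite dotvE. Qed.

Lemma dotv_mulmxl k l (A : 'M[R]_(k, l)) u v :
  dotv (A *m u) v = dotv u (A^T *m v).
Proof. by rewrite !dotvE trmx_mul mulmxA. Qed.

Lemma dotv_delta k (u : 'cV[R]_k) i : dotv (delta_mx i 0) u = u i 0.
Proof.
rewrite /dotv (bigD1 i) //= big1 ?addr0 => [|j /negPf ji].
  by rewrite mxE !eqxx mul1r.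
by rewrite mxE ji mul0r.
Qed.

Lemma dotv_ge0 k (u : 'cV[R]_k) : 0 <= dotv u u.
Proof. by apply: sumr_ge0 => i _; rewrite -expr2 sqr_ge0. Qed.

Lemma dotv_eq0 k (u : 'cV[R]_k) : (dotv u u == 0) = (u == 0).
Proof.
apply/eqP/eqP => [u0|->]; last exact: dotv0.
apply/matrixP => i j; rewrite (ord1 j) mxE; apply/eqP; rewrite -sqrf_eq0 expr2.
rewrite (@psumr_eq0P _ _ predT (fun i => u i 0 * u i 0)) // => l _.
by rewrite -expr2 sqr_ge0.
Qed.

Lemma usphereP k (x : 'cV[R]_k) : (x \in usphere R k) <-> dotv x x = 1.
Proof.
rewrite inE /usphere /= /enorm; split => [x1|->]; last by rewrite sqrtr1.
by rewrite -(sqr_sqrtr (dotv_ge0 x)) x1 expr1n.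
Qed.

Lemma normalize_sphere k (x : 'cV[R]_k) :
  0 < dotv x x -> dotv (normalize x) (normalize x) = 1.
Proof.
move=> x0; rewrite dotvZl dotvZr mulrA -invfM -expr2 sqr_sqrtr ?ltW //.
by rewrite mulVf // gt_eqF.
Qed.

End Dot.

(** * Derivatives along great circles *)

Section Curve.
Variables (R : realType) (p : nat).
Implicit Types x v : 'cV[R]_p.

(** [sderive] extends a map by homogeneity of degree 0, so its difference quotient at [x] only sees
    this parametrised arc of a great circle. *)
Definition great_curve x v (h : R) : 'cV[R]_p := normalize (h *: v + x).

Variables (x v : 'cV[R]_p).
Hypotheses (x1 : dotv x x = 1) (xv : dotv v x = 0).

Lemma dotv_line h : dotv (h *: v + x) (h *: v + x) = 1 + h ^+ 2 * dotv v v.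
Proof. rewrite !dotv_linE x1 (dotvC x) xv; ring. Qed.

Lemma dotv_line_gt0 h : 0 < dotv (h *: v + x) (h *: v + x).
Proof. by rewrite dotv_line ltr_wpDr // mulr_ge0 ?sqr_ge0 ?dotv_ge0. Qed.

Lemma great_curve_sphere h :
  dotv (great_curve x v h) (great_curve x v h) = 1.
Proof. exact/normalize_sphere/dotv_line_gt0. Qed.

Lemma great_curve0 : great_curve x v 0 = x.
Proof.
by rewrite /great_curve scale0r add0r /normalize /enorm x1 sqrtr1 invr1 scale1r.
Qed.

(** Before normalisation the squared norm is [1 + h^2 |v|^2], with no linear term in [h]; the
    normalising factor therefore has derivative 0 at [h = 0]. *)
Lemma great_curve_is_derive i :
  is_derive (0 : R) 1 (fun h => great_curve x v h i 0) (v i 0).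
Proof.
have -> : (fun h => great_curve x v h i 0) =
    (fun h => (Num.sqrt (1 + h ^+ 2 * dotv v v))^-1) * (fun h => h * v i 0 + x i 0).
  by apply/funext => h; rewrite /great_curve /normalize /enorm dotv_line !mxE.
have d1 : is_derive (0 : R) 1 (fun h : R => 1 + h ^+ 2 * dotv v v) 0.
  have -> : (fun h : R => 1 + h ^+ 2 * dotv v v) =
      cst 1 + (dotv v v \*: (fun h : R => h) ^+ 2).
    by apply/funext => h; rewrite !fctE /= mulrC.
  by apply: is_derive_eq; rewrite expr1 mulr0 scale0r scaler0 addr0.
have d2 : is_derive (0 : R) 1 (fun h : R => Num.sqrt (1 + h ^+ 2 * dotv v v)) 0.
  have -> : (fun h : R => Num.sqrt (1 + h ^+ 2 * dotv v v)) =
     Num.sqrt \o (fun h : R => 1 + h ^+ 2 * dotv v v) by [].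
  have d3 : is_derive ((fun h : R => 1 + h ^+ 2 * dotv v v) 0) 1 Num.sqrt
      (2 * Num.sqrt 1 : R)^-1.
    by rewrite expr0n /= mul0r addr0; exact: is_derive1_sqrt.
  by have := @is_derive1_comp R _ (fun h : R => 1 + h ^+ 2 * dotv v v) _ _ _ d3 d1; rewrite mulr0.
have d4 : is_derive (0 : R) 1 (fun h : R => (Num.sqrt (1 + h ^+ 2 * dotv v v))^-1) 0.
  have /(_ _)d4 := is_deriveV _ d2.
  apply: is_derive_eq; first apply: d4; last by rewrite scaler0.
  by rewrite expr0n mul0r addr0 sqrtr1 oner_eq0.
have d5 : is_derive (0 : R) 1 (fun h : R => h * v i 0 + x i 0) (v i 0).
  have -> : (fun h : R => h * v i 0 + x i 0) = (v i 0 \*: id) + cst (x i 0).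
    by apply/funext => h; rewrite !fctE /= mulrC.
  by apply: is_derive_eq; rewrite addr0 scaler1.
apply: is_derive_eq.
by rewrite scaler0 addr0 expr0n mul0r addr0 sqrtr1 invr1 scale1r.
Qed.

End Curve.

Section Sder.
Variables (R : realType) (p : nat).

(** A relation that records differentiability together with the value, so that product rules
    compose; [sder_sderive] recovers the total function [sderive]. *)
Definition sder q (s : 'cV[R]_p -> 'cV[R]_q) (x v : 'cV[R]_p) (d : 'cV[R]_q) :=
  forall i, is_derive (0 : R) 1 (fun h => s (great_curve x v h) i 0) (d i 0).

Lemma sder_sderive q (s : 'cV[R]_p -> 'cV[R]_q) x v d :
  sder s x v d -> sderive s x v = d.
Proof.
move=> sd; rewrite /sderive.
set g := fun h => s (great_curve x v h).
have gd : derivable g 0 1.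
  have [_ +] := derivable_mxP g 0 1; apply => i j; rewrite (ord1 j).
  by have [] := sd i.
transitivity ('D_1 g 0); last first.
  rewrite derive_mx //; apply/matrixP => i j; rewrite mxE (ord1 j).
  by have [_ ->] := sd i.
have E : (fun h : R => h^-1 *: (((s \o @normalize R p) \o shift x) (h *: v) -
      (s \o @normalize R p) x)) =
    (fun h : R => h^-1 *: ((g \o shift 0) (h *: 1) - g 0)).
  apply/funext => h /=.
  by rewrite /g /great_curve addr0 [_ *: 1]mulr1 scale0r add0r.
by rewrite /derive E.
Qed.

Variables (x v : 'cV[R]_p).
Hypotheses (x1 : dotv x x = 1) (xv : dotv v x = 0).

(** The curve stays on the sphere, so closed formulas that hold only there may be differentiated. *)
Lemma sder_ext q (s t : 'cV[R]_p -> 'cV[R]_q) d :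
  (forall y, dotv y y = 1 -> s y = t y) -> sder s x v d -> sder t x v d.
Proof.
move=> st sd i.
have -> : (fun h => t (great_curve x v h) i 0) = (fun h => s (great_curve x v h) i 0).
  by apply/funext => h; rewrite st // great_curve_sphere.
exact: sd.
Qed.

Lemma sder_id : sder id x v v.
Proof. by move=> i; apply: great_curve_is_derive. Qed.

Lemma sder_cst q (w : 'cV[R]_q) : sder (fun=> w) x v 0.
Proof. by move=> i; rewrite mxE; apply: is_derive_cst. Qed.

Lemma sder_add q (s t : 'cV[R]_p -> 'cV[R]_q) ds dt :
  sder s x v ds -> sder t x v dt -> sder (fun y => s y + t y) x v (ds + dt).
Proof.
move=> sd td i; rewrite mxE.
have -> : (fun h => (s (great_curve x v h) + t (great_curve x v h)) i 0) =
  (fun h => s (great_curve x v h) i 0) + (fun h => t (great_curve x v h) i 0).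
  by apply/funext => h; rewrite !mxE.
exact: is_deriveD.
Qed.

Lemma sder_dotv q (s t : 'cV[R]_p -> 'cV[R]_q) ds dt :
  sder s x v ds -> sder t x v dt ->
  is_derive (0 : R) 1 (fun h => dotv (s (great_curve x v h)) (t (great_curve x v h)))
    (dotv ds (t x) + dotv (s x) dt).
Proof.
move=> sd td; rewrite /dotv.
have -> : (fun h => \sum_i s (great_curve x v h) i 0 * t (great_curve x v h) i 0) =
  \sum_i (fun h => s (great_curve x v h) i 0) * (fun h => t (great_curve x v h) i 0).
  by apply/funext => h; rewrite fct_sumE.
rewrite -big_split /=; apply: is_derive_sum => i.
apply: is_derive_eq; first by apply: is_deriveM; [exact: sd|exact: td].
rewrite /= great_curve0 // addrC; congr (_ + _); exact: mulrC.
Qed.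

(** The product rule for tangential projections, whose coefficients have the form
    [dotv (s y) (t y)]. *)
Lemma sder_scale q r (s t : 'cV[R]_p -> 'cV[R]_q) (u : 'cV[R]_p -> 'cV[R]_r) ds dt du :
  sder s x v ds -> sder t x v dt -> sder u x v du ->
  sder (fun y => dotv (s y) (t y) *: u y) x v
    ((dotv ds (t x) + dotv (s x) dt) *: u x + dotv (s x) (t x) *: du).
Proof.
move=> sd td ud i.
have -> : (fun h => (dotv (s (great_curve x v h)) (t (great_curve x v h)) *:
                     u (great_curve x v h)) i 0) =
  (fun h => dotv (s (great_curve x v h)) (t (great_curve x v h))) *
  (fun h => u (great_curve x v h) i 0).
  by apply/funext => h; rewrite !mxE.
apply: is_derive_eq.
  by apply: is_deriveM; [exact: (sder_dotv sd td)|exact: ud].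
rewrite /= great_curve0 // !mxE addrC; congr (_ + _); exact: mulrC.
Qed.

Lemma sder_scalec q (a : R) (s : 'cV[R]_p -> 'cV[R]_q) ds :
  sder s x v ds -> sder (fun y => a *: s y) x v (a *: ds).
Proof.
move=> sd i; rewrite mxE.
have -> : (fun h => (a *: s (great_curve x v h)) i 0) =
  a \*: (fun h => s (great_curve x v h) i 0).
  by apply/funext => h; rewrite !mxE.
exact: is_deriveZ.
Qed.

Lemma sder_opp q (s : 'cV[R]_p -> 'cV[R]_q) ds :
  sder s x v ds -> sder (fun y => - s y) x v (- ds).
Proof.
move=> /(sder_scalec (-1)); rewrite scaleN1r; apply: sder_ext => y _.
by rewrite scaleN1r.
Qed.

Lemma sder_mulmx q r (A : 'M[R]_(r, q)) (s : 'cV[R]_p -> 'cV[R]_q) ds :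
  sder s x v ds -> sder (fun y => A *m s y) x v (A *m ds).
Proof.
move=> sd i.
have E : forall w : 'cV[R]_q, (A *m w) i 0 = dotv ((row i A)^T) w.
  by move=> w; rewrite mxE; apply: eq_bigr => j _; rewrite !mxE.
have -> : (fun h => (A *m s (great_curve x v h)) i 0) =
  (fun h => dotv ((row i A)^T) (s (great_curve x v h))).
  by apply/funext => h; rewrite E.
rewrite E; apply: is_derive_eq; first exact: (sder_dotv (sder_cst _) sd).
by rewrite dot0v add0r.
Qed.

End Sder.

(** * Tension and bitension of quadratic maps *)

Section TangentPart.
Variable R : realType.

Lemma tangent_partD k (y u v : 'cV[R]_k) :
  tangent_part y (u + v) = tangent_part y u + tangent_part y v.
Proof. by rewrite /tangent_part dotvDl scalerDl opprD addrACA. Qed.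

Lemma tangent_partZ k (y : 'cV[R]_k) a u :
  tangent_part y (a *: u) = a *: tangent_part y u.
Proof. by rewrite /tangent_part dotvZl -scalerA scalerBr. Qed.

Lemma tangent_partN k (y u : 'cV[R]_k) :
  tangent_part y (- u) = - tangent_part y u.
Proof. by rewrite -scaleN1r tangent_partZ scaleN1r. Qed.

Lemma tangent_part_sum k (I : finType) (y : 'cV[R]_k) (u : I -> 'cV[R]_k) :
  tangent_part y (\sum_a u a) = \sum_a tangent_part y (u a).
Proof.
apply: (big_ind2 (fun s t => tangent_part y s = t)) => //.
  by rewrite /tangent_part dot0v scale0r subr0.
by move=> s1 t1 s2 t2 <- <-; rewrite tangent_partD.
Qed.

Lemma tangent_part_id k (y u : 'cV[R]_k) : dotv u y = 0 -> tangent_part y u = u.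
Proof. by rewrite /tangent_part => ->; rewrite scale0r subr0. Qed.

Lemma tangent_part_self k (y : 'cV[R]_k) : dotv y y = 1 -> tangent_part y y = 0.
Proof. by rewrite /tangent_part => ->; rewrite scale1r subrr. Qed.

Lemma tangent_part_dotv k (y u : 'cV[R]_k) :
  dotv y y = 1 -> dotv (tangent_part y u) y = 0.
Proof. by rewrite /tangent_part => y1; rewrite !dotv_linE y1 mulr1 subrr. Qed.

Lemma sder_tangent_field p (w x v : 'cV[R]_p) :
  dotv x x = 1 -> dotv v x = 0 ->
  sder (tangent_field w) x v (- (dotv w v *: x + dotv w x *: v)).
Proof.
move=> x1 vx; have -> : - (dotv w v *: x + dotv w x *: v) =
    0 + - ((dotv 0 x + dotv w v) *: x + dotv w x *: v) by rewrite dot0v !add0r.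
apply: sder_add => //; first exact: sder_cst.
apply: sder_opp => //; apply: sder_scale => //; [exact: sder_cst|exact: sder_id..].
Qed.

(** The derivative of [w - <w, x> x] along [v] is [- <w, v> x - <w, x> v]; projecting removes the
    first term, which is normal. *)
Lemma levi_civita_tangent_field p (X : 'cV[R]_p -> 'cV[R]_p) (w x : 'cV[R]_p) :
  dotv x x = 1 -> dotv (X x) x = 0 ->
  levi_civita X (tangent_field w) x = - (dotv w x *: X x).
Proof.
move=> x1 xX; rewrite /levi_civita /pullback_conn.
rewrite (sder_sderive (sder_tangent_field w x1 xX)).
rewrite tangent_partN tangent_partD !tangent_partZ tangent_part_self //.
by rewrite scaler0 add0r tangent_part_id.
Qed.

(** Constant curvature 1. For projected constant fields each second covariant derivative is explicit
    at [y] ([half]). *)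
Lemma curvatureE k (y u v w : 'cV[R]_k) : dotv y y = 1 ->
  dotv u y = 0 -> dotv v y = 0 -> dotv w y = 0 ->
  curvature y u v w = dotv v w *: u - dotv u w *: v.
Proof.
move=> y1 uy vy wy; rewrite /curvature.
have half (a b : 'cV[R]_k) : dotv a y = 0 -> dotv b y = 0 ->
    levi_civita (tangent_field a) (levi_civita (tangent_field b) (tangent_field w)) y
    = - (dotv a w *: b).
  move=> ay by0; rewrite {1}/levi_civita /pullback_conn.
  have fa : tangent_field a y = a by exact: tangent_part_id.
  have fb : tangent_field b y = b by exact: tangent_part_id.
  rewrite fa.
  have d : sder (fun z => - (dotv w z *: tangent_field b z)) y a
      (- ((dotv 0 y + dotv w a) *: tangent_field b y +
          dotv w y *: - (dotv b a *: y + dotv b y *: a))).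
    apply: sder_opp => //; apply: sder_scale => //.
    - exact: sder_cst.
    - exact: sder_id.
    - exact: sder_tangent_field.
  rewrite (@sder_sderive _ _ _ _ _ _
    (- ((dotv 0 y + dotv w a) *: tangent_field b y +
          dotv w y *: - (dotv b a *: y + dotv b y *: a)))); last first.
    apply: sder_ext d => // z z1.
    by rewrite levi_civita_tangent_field // tangent_part_dotv.
  rewrite wy scale0r addr0 dot0v add0r fb tangent_partN tangent_partZ.
  by rewrite tangent_part_id // dotvC.
(* Both derivatives in the bracket equal [- <u, v> y] at [y], so the bracket vanishes there. *)
have -> : levi_civita (lie_bracket (tangent_field u) (tangent_field v))
    (tangent_field w) y = 0.
  have lb : lie_bracket (tangent_field u) (tangent_field v) y = 0.
    have fu : tangent_field u y = u by exact: tangent_part_id.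
    have fv : tangent_field v y = v by exact: tangent_part_id.
    rewrite /lie_bracket fu fv.
    rewrite !(sder_sderive (sder_tangent_field _ y1 _)) //.
    by rewrite uy vy !scale0r !addr0 (dotvC v u) opprK addrC subrr.
  by rewrite levi_civita_tangent_field ?lb ?dot0v // wy scale0r oppr0.
by rewrite !half // opprK subr0 addrC.
Qed.

End TangentPart.

Section QuadraticSphereMap.
Variables (R : realType) (p q : nat) (A : 'I_q -> 'M[R]_p).

Definition bil (u v : 'cV[R]_p) : 'cV[R]_q := \col_i dotv u (A i *m v).

Definition mxtraces : 'cV[R]_q := \col_i \tr (A i).

(** The matrix of the form [dotv w (bil x x)]; at [w = mxtraces] it is the matrix M of f. *)
Definition pencil (w : 'cV[R]_q) : 'M[R]_p := \sum_i w i 0 *: A i.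

Lemma bilDl u v w : bil (u + v) w = bil u w + bil v w.
Proof. by apply/matrixP => i j; rewrite !mxE dotvDl. Qed.

Lemma bilDr u v w : bil w (u + v) = bil w u + bil w v.
Proof. by apply/matrixP => i j; rewrite !mxE mulmxDr dotvDr. Qed.

Lemma bilZl a u w : bil (a *: u) w = a *: bil u w.
Proof. by apply/matrixP => i j; rewrite !mxE dotvZl. Qed.

Lemma bilZr a u w : bil w (a *: u) = a *: bil w u.
Proof. by apply/matrixP => i j; rewrite !mxE -scalemxAr dotvZr. Qed.

Lemma bilNr u w : bil w (- u) = - bil w u.
Proof. by rewrite -scaleN1r bilZr scaleN1r. Qed.

Lemma dotv_bil w u v : dotv w (bil u v) = dotv u (pencil w *m v).
Proof.
rewrite /pencil mulmx_suml dotv_sumr; apply: eq_bigr => i _.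
by rewrite mxE -scalemxAl dotvZr.
Qed.

Lemma frameE (a : 'I_p) (x : 'cV[R]_p) : frame a x = delta_mx a 0 - x a 0 *: x.
Proof. by rewrite /frame /tangent_field /tangent_part dotv_delta. Qed.

(** The sum is the trace of [P M P], where [P = 1 - x x^T] projects onto the tangent space. *)
Lemma sum_frame_mulmx (M : 'M[R]_p) x : dotv x x = 1 ->
  \sum_a dotv (frame a x) (M *m frame a x) = \tr M - dotv x (M *m x).
Proof.
move=> x1.
have E a : dotv (frame a x) (M *m frame a x) =
    M a a - x a 0 * (M^T *m x) a 0 - x a 0 * (M *m x) a 0
    + x a 0 * x a 0 * dotv x (M *m x).
  have d1 : dotv x (M *m delta_mx a 0) = (M^T *m x) a 0.
    by rewrite dotvC dotv_mulmxl dotv_delta.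
  have d2 : dotv (delta_mx a 0) (M *m delta_mx a 0) = M a a.
    by rewrite dotv_delta -colE mxE.
  rewrite frameE mulmxBr -scalemxAr !dotv_linE d1 d2 dotv_delta; ring.
under eq_bigr do rewrite E.
rewrite !big_split /= -mulr_suml !sumrN.
have -> : \sum_a x a 0 * x a 0 = 1 by [].
have -> : \sum_a x a 0 * (M^T *m x) a 0 = dotv x (M *m x).
  by rewrite dotvC dotv_mulmxl.
have -> : \sum_a x a 0 * (M *m x) a 0 = dotv x (M *m x) by [].
rewrite /mxtrace; ring.
Qed.

(** The case [M = l m^T] of [sum_frame_mulmx]. *)
Lemma sum_frame_dotv (l m x : 'cV[R]_p) : dotv x x = 1 ->
  \sum_a dotv l (frame a x) * dotv m (frame a x) = dotv l m - dotv l x * dotv m x.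
Proof.
move=> x1.
have E (u : 'cV[R]_p) : dotv u ((l *m m^T) *m u) = dotv l u * dotv m u.
  by rewrite -mulmxA [m^T *m u]mx11_scalar -dotvE mul_mx_scalar dotvZr mulrC dotvC.
under eq_bigr do rewrite -E.
by rewrite sum_frame_mulmx // E mxtrace_mulC [_ *m l]mx11_scalar -dotvE mxtrace_scalar (dotvC m).
Qed.

Lemma sum_frame_bil x : dotv x x = 1 ->
  \sum_a bil (frame a x) (frame a x) = mxtraces - bil x x.
Proof.
move=> x1; apply/matrixP => i j; rewrite !mxE summxE -sum_frame_mulmx //.
by apply: eq_bigr => a _; rewrite mxE.
Qed.

Lemma sder_bil (s t : 'cV[R]_p -> 'cV[R]_p) x v ds dt :
  dotv x x = 1 -> dotv v x = 0 -> sder s x v ds -> sder t x v dt ->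
  sder (fun y => bil (s y) (t y)) x v (bil ds (t x) + bil (s x) dt).
Proof.
move=> x1 vx sd td i; rewrite !mxE.
have D := sder_dotv x1 sd (sder_mulmx x1 (A i) td).
have E : (fun h => bil (s (great_curve x v h)) (t (great_curve x v h)) i 0) =
    (fun h => dotv (s (great_curve x v h)) (A i *m t (great_curve x v h))).
  by apply/funext => h; rewrite mxE.
by rewrite E; exact: D.
Qed.

Hypothesis symA : forall i, (A i)^T = A i.

Lemma bilC u v : bil u v = bil v u.
Proof. by apply/matrixP => i j; rewrite !mxE dotvC dotv_mulmxl symA. Qed.

Lemma pencil_sym w : (pencil w)^T = pencil w.
Proof.
by rewrite /pencil raddf_sum /=; apply: eq_bigr => i _; rewrite linearZ /= symA.
Qed.

Hypothesis bil_norm : forall y, dotv (bil y y) (bil y y) = dotv y y ^+ 2.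

(** These compare the coefficients of [t] and [t^2] in |F(x + t v)|^2 = |x + t v|^4. *)
Lemma bil_polarisation x v : dotv x x = 1 -> dotv v x = 0 ->
  dotv (bil x x) (bil x v) = 0 /\
  2 * dotv (bil x x) (bil v v) + 4 * dotv (bil x v) (bil x v) = 2 * dotv v v.
Proof.
move=> x1 vx.
have E (t : R) : 1 + 4 * t * dotv (bil x x) (bil x v)
    + t ^+ 2 * (2 * dotv (bil x x) (bil v v) + 4 * dotv (bil x v) (bil x v))
    + 4 * t ^+ 3 * dotv (bil x v) (bil v v) + t ^+ 4 * dotv v v ^+ 2
    = (1 + t ^+ 2 * dotv v v) ^+ 2.
  have <- : dotv (t *: v + x) (t *: v + x) = 1 + t ^+ 2 * dotv v v.
    exact: dotv_line.
  rewrite -(bil_norm (t *: v + x)) !(bilDl, bilDr, bilZl, bilZr) (bilC v x) !dotv_linE.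
  rewrite !bil_norm x1 (dotvC (bil x v) (bil x x)) (dotvC (bil v v) (bil x x)).
  rewrite (dotvC (bil v v) (bil x v)); ring.
(* The constant and quartic coefficients already agree, so three nonzero values of [t] determine the
   other three. *)
have := E 1; have := E (-1); have := E 2; rewrite !expr2 !exprS !expr0.
split; lra.
Qed.

End QuadraticSphereMap.

(** * Explicit tension and bitension fields *)

Section Bitension.
Variables (R : realType) (p q : nat) (A : 'I_q -> 'M[R]_p).
Variable phi : 'cV[R]_p -> 'cV[R]_q.
Hypothesis symA : forall i, (A i)^T = A i.
Hypothesis bil_norm : forall y, dotv (bil A y y) (bil A y y) = dotv y y ^+ 2.
Hypothesis phiE : forall y, dotv y y = 1 -> phi y = bil A y y.

Local Notation T := (mxtraces A).

Let F1 y : dotv y y = 1 -> dotv (bil A y y) (bil A y y) = 1.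
Proof. by move=> y1; rewrite bil_norm y1 expr1n. Qed.

Let frame_tan (a : 'I_p) (y : 'cV[R]_p) : dotv y y = 1 -> dotv (frame a y) y = 0.
Proof. exact: tangent_part_dotv. Qed.

Let bil_tan x v : dotv x x = 1 -> dotv v x = 0 -> dotv (bil A x v) (bil A x x) = 0.
Proof. by move=> x1 vx; have [+ _] := bil_polarisation symA bil_norm x1 vx; rewrite dotvC. Qed.

Lemma sder_bil_diag x v : dotv x x = 1 -> dotv v x = 0 ->
  sder (fun y => bil A y y) x v (2 *: bil A x v).
Proof.
move=> x1 vx; have -> : 2 *: bil A x v = bil A v x + bil A x v.
  by rewrite (bilC symA v) -mulr2n scaler_nat.
by apply: sder_bil => //; exact: sder_id.
Qed.

Lemma differentialE X x : dotv x x = 1 -> dotv (X x) x = 0 ->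
  differential phi X x = 2 *: bil A x (X x).
Proof.
move=> x1 Xx; apply: sder_sderive; apply: (sder_ext x1 Xx _ (sder_bil_diag x1 Xx)).
by move=> y /phiE.
Qed.

Lemma levi_civita_frame (a : 'I_p) (x : 'cV[R]_p) : dotv x x = 1 ->
  levi_civita (frame a) (@frame R p a) x = - (x a 0 *: frame a x).
Proof.
by move=> x1; rewrite levi_civita_tangent_field ?frame_tan // dotv_delta.
Qed.

Lemma sder_frame (a : 'I_p) (x v : 'cV[R]_p) : dotv x x = 1 -> dotv v x = 0 ->
  sder (frame a) x v (- (v a 0 *: x + x a 0 *: v)).
Proof.
move=> x1 vx; have := sder_tangent_field (delta_mx a 0) x1 vx.
by rewrite !dotv_delta.
Qed.

Let frame_bil_tan (a : 'I_p) x : dotv x x = 1 ->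
  tangent_part (bil A x x) (bil A x (frame a x)) = bil A x (frame a x).
Proof. by move=> x1; rewrite tangent_part_id // bil_tan // frame_tan. Qed.

(** The field [frame a] is not parallel: its covariant derivative along itself is
    [- x a 0 *: frame a x]. This contributes the same multiple of [bil A x (frame a x)] to both
    terms of the second fundamental form, where it cancels. *)
Lemma second_fundamental_form_frame (a : 'I_p) x : dotv x x = 1 ->
  second_fundamental_form phi (frame a) (frame a) x =
  2 *: tangent_part (bil A x x) (bil A (frame a x) (frame a x)).
Proof.
move=> x1; have fx := frame_tan a x1.
rewrite /second_fundamental_form /pullback_conn phiE //.
have D : sder (fun y => 2 *: bil A y (frame a y)) x (frame a x)
   (2 *: (bil A (frame a x) (frame a x) +
          bil A x (- (frame a x a 0 *: x + x a 0 *: frame a x)))).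
  apply: sder_scalec => //; apply: sder_bil => //; [exact: sder_id|exact: sder_frame].
rewrite (@sder_sderive _ _ _ _ _ _ (2 *: (bil A (frame a x) (frame a x) +
          bil A x (- (frame a x a 0 *: x + x a 0 *: frame a x))))); last first.
  by apply: sder_ext D => // y y1; rewrite differentialE // frame_tan.
rewrite differentialE //; last first.
  by rewrite levi_civita_frame // dotvNl dotvZl fx mulr0 oppr0.
rewrite levi_civita_frame // !bilNr (bilDr A (frame a x a 0 *: x)) !bilZr.
rewrite tangent_partZ tangent_partD tangent_partN tangent_partD !tangent_partZ.
by rewrite frame_bil_tan // tangent_part_self ?F1 // scaler0 add0r -scalerBr opprK addrNK.
Qed.

Lemma tensionE x : dotv x x = 1 ->
  tension phi x = 2 *: tangent_part (bil A x x) T.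
Proof.
move=> x1; rewrite /tension /trace_tangent.
under eq_bigr do rewrite second_fundamental_form_frame //.
rewrite -scaler_sumr -tangent_part_sum sum_frame_bil // tangent_partD tangent_partN.
by rewrite tangent_part_self ?F1 // subr0.
Qed.

(** Differentiating [T - <T, F> F] gives a multiple of [F], which is normal, and [- <T, F> dF],
    which is tangent; [tension] and [dF] each bring a factor 2. *)
Lemma pullback_conn_tension X x : dotv x x = 1 -> dotv (X x) x = 0 ->
  pullback_conn phi X (tension phi) x =
  - 4 *: (dotv T (bil A x x) *: bil A x (X x)).
Proof.
move=> x1 Xx; rewrite /pullback_conn phiE //.
have D : sder (fun y => 2 *: (T - dotv T (bil A y y) *: bil A y y)) x (X x)
  (2 *: (0 - ((dotv 0 (bil A x x) + dotv T (2 *: bil A x (X x))) *: bil A x x +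
       dotv T (bil A x x) *: (2 *: bil A x (X x))))).
  apply: sder_scalec => //; apply: sder_add => //; first exact: sder_cst.
  apply: sder_opp => //; apply: sder_scale => //; first exact: sder_cst.
    exact: sder_bil_diag.
  exact: sder_bil_diag.
rewrite (@sder_sderive _ _ _ _ _ _ (2 *: (0 - ((dotv 0 (bil A x x) +
  dotv T (2 *: bil A x (X x))) *: bil A x x +
       dotv T (bil A x x) *: (2 *: bil A x (X x)))))); last first.
  by apply: sder_ext D => // y y1; rewrite tensionE.
rewrite sub0r tangent_partZ tangent_partN tangent_partD !tangent_partZ.
rewrite tangent_part_self ?F1 // scaler0 add0r tangent_part_id; last exact: bil_tan.
move: (bil A x (X x)) (dotv T (bil A x x)) => b f.
by apply/matrixP => i j; rewrite !mxE; ring.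
Qed.

Lemma second_covariant_frame (a : 'I_p) x : dotv x x = 1 ->
  second_covariant phi (tension phi) (frame a) (frame a) x =
  - 4 *: ((2 * dotv T (bil A x (frame a x))) *: bil A x (frame a x) +
   dotv T (bil A x x) *: tangent_part (bil A x x) (bil A (frame a x) (frame a x))).
Proof.
move=> x1; have fx := frame_tan a x1.
rewrite /second_covariant pullback_conn_tension //; last first.
  by rewrite levi_civita_frame // dotvNl dotvZl fx mulr0 oppr0.
rewrite {1}/pullback_conn phiE //.
set d := bil A (frame a x) (frame a x) +
          bil A x (- (frame a x a 0 *: x + x a 0 *: frame a x)).
have D : sder (fun y => - 4 *: (dotv T (bil A y y) *: bil A y (frame a y))) x (frame a x)
   (- 4 *: ((dotv 0 (bil A x x) + dotv T (2 *: bil A x (frame a x))) *: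
     bil A x (frame a x) + dotv T (bil A x x) *: d)).
  apply: sder_scalec => //; apply: sder_scale => //; first exact: sder_cst.
    exact: sder_bil_diag.
  by apply: sder_bil => //; [exact: sder_id|exact: sder_frame].
rewrite (@sder_sderive _ _ _ _ _ _ (- 4 *: ((dotv 0 (bil A x x) +
    dotv T (2 *: bil A x (frame a x))) *:
     bil A x (frame a x) + dotv T (bil A x x) *: d))); last first.
  by apply: sder_ext D => // y y1; rewrite pullback_conn_tension // frame_tan.
rewrite levi_civita_frame // /d !bilNr (bilDr A (frame a x a 0 *: x)) !bilZr dot0v add0r dotvZr.
rewrite tangent_partZ -scalerBr; congr (_ *: _).
rewrite tangent_partD !tangent_partZ frame_bil_tan // -addrA; congr (_ + _).
rewrite tangent_partD tangent_partN tangent_partD !tangent_partZ frame_bil_tan //.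
by rewrite tangent_part_self ?F1 // scaler0 add0r -scalerBr opprK addrNK.
Qed.

(** The [- 16] is the sum of [- 8] from the second covariant derivative and [- 8] from the
    curvature. In the last coefficient, [8] comes from the curvature and [- 4] from the second
    covariant derivative. *)
Lemma bitensionE x : dotv x x = 1 ->
  bitension phi x =
  - 16 *: (\sum_a dotv T (bil A x (frame a x)) *: bil A x (frame a x)) +
  (8 * \sum_a dotv (bil A x (frame a x)) (bil A x (frame a x))
   - 4 * dotv T (bil A x x)) *: tangent_part (bil A x x) T.
Proof.
move=> x1.
(* Constant curvature turns [R(dphi, tau) dphi] into [<tau, dphi> dphi - <dphi, dphi> tau]; three
   factors 2 make the 8. *)
have C (a : 'I_p) : curvature (phi x) (differential phi (frame a) x) (tension phi x)
    (differential phi (frame a) x) =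
    8 *: (dotv T (bil A x (frame a x)) *: bil A x (frame a x)) -
    dotv (bil A x (frame a x)) (bil A x (frame a x)) *: (8 *: tangent_part (bil A x x) T).
  have bx := bil_tan x1 (frame_tan a x1).
  rewrite phiE // tensionE // differentialE ?frame_tan // curvatureE ?F1 //.
  - have tb : dotv (tangent_part (bil A x x) T) (bil A x (frame a x)) =
        dotv T (bil A x (frame a x)).
      by rewrite /tangent_part !dotv_linE (dotvC (bil A x x)) bx mulr0 subr0.
    rewrite !(dotvZl, dotvZr) tb; congr (_ - _).
      by rewrite !scalerA; congr (_ *: _); ring.
    by rewrite !scalerA; congr (_ *: _); ring.
  - by rewrite dotvZl bx mulr0.
  - by rewrite dotvZl tangent_part_dotv ?F1 // mulr0.
  - by rewrite dotvZl bx mulr0.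
have -> : bitension phi x =
    \sum_(a < p) (- 4 *: ((2 * dotv T (bil A x (frame a x))) *: bil A x (frame a x) +
   dotv T (bil A x x) *: tangent_part (bil A x x) (bil A (frame a x) (frame a x)))) -
    \sum_(a < p) (8 *: (dotv T (bil A x (frame a x)) *: bil A x (frame a x)) -
    dotv (bil A x (frame a x)) (bil A x (frame a x)) *: (8 *: tangent_part (bil A x x) T)).
  rewrite /bitension /rough_laplacian opprK; congr (_ - _); apply: eq_bigr => a _.
    exact: second_covariant_frame.
  exact: C.
rewrite -scaler_sumr big_split /= -scaler_sumr -tangent_part_sum sum_frame_bil //.
rewrite tangent_partD tangent_partN tangent_part_self ?F1 // subr0.
rewrite big_split /= -scaler_sumr sumrN -scaler_suml.
rewrite (eq_bigr (fun a => 2 *: (dotv T (bil A x (frame a x)) *: bil A x (frame a x))));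
  last by move=> a _; rewrite scalerA.
rewrite -scaler_sumr.
set W := \sum_a _; set P := tangent_part _ _; set S := \sum_a _; set f := dotv T _.
apply/matrixP => i j; rewrite !mxE; ring.
Qed.

End Bitension.

Section Dimension4.
Variables (R : realType) (q : nat) (A : 'I_q -> 'M[R]_4).
Variable phi : 'cV[R]_4 -> 'cV[R]_q.
Hypothesis symA : forall i, (A i)^T = A i.
Hypothesis bil_norm : forall y, dotv (bil A y y) (bil A y y) = dotv y y ^+ 2.
Hypothesis phiE : forall y, dotv y y = 1 -> phi y = bil A y y.
Hypothesis biharmonic_phi : biharmonic_map phi.

Local Notation T := (mxtraces A).

Lemma biharmonic_scalar x : dotv x x = 1 ->
  2 * (dotv (pencil A T *m x) (pencil A T *m x) - dotv T (bil A x x) ^+ 2) =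
  (2 - dotv T (bil A x x)) * (dotv T T - dotv T (bil A x x) ^+ 2).
Proof.
move=> x1; have /biharmonic_phi : x \in usphere R 4 by exact/usphereP.
rewrite (bitensionE symA bil_norm phiE) // => /(congr1 (dotv T)).
rewrite dotv0 dotvDr !dotvZr dotv_sumr /tangent_part.
set M := pencil A T; set f := dotv T (bil A x x).
(* The pairings are [<M x, frame a x>], so the sum is the squared length of the tangential part of
   [M x]. *)
have -> : \sum_(a < 4) dotv T (dotv T (bil A x (frame a x)) *: bil A x (frame a x)) =
    dotv (M *m x) (M *m x) - f ^+ 2.
  under eq_bigr => a _.
    rewrite dotvZr dotv_bil -[pencil A T](pencil_sym symA) -dotv_mulmxl.
    over.
  rewrite sum_frame_dotv //; congr (_ - _).
  by rewrite /f dotv_bil -/M [dotv (M *m x) x]dotvC expr2.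
(* The dimension enters here: the polarisation identity is summed over a frame of total squared
   length 3. *)
have -> : \sum_(a < 4) dotv (bil A x (frame a x)) (bil A x (frame a x)) = 2 - f / 2.
  have h (a : 'I_4) : dotv (bil A x (frame a x)) (bil A x (frame a x)) =
      dotv (frame a x) (frame a x) / 2 -
      dotv (bil A x x) (bil A (frame a x) (frame a x)) / 2.
    have ex : dotv (frame a x) x = 0 by exact: tangent_part_dotv.
    by have [_ /= ] := bil_polarisation symA bil_norm x1 ex; lra.
  under eq_bigr do rewrite h.
  rewrite big_split /= sumrN -!mulr_suml -dotv_sumr sum_frame_bil //.
  have -> : \sum_(a < 4) dotv (frame a x) (frame a x) = 3.
    have := sum_frame_mulmx 1%:M x1; under eq_bigr do rewrite mul1mx.
    by move=> ->; rewrite mul1mx x1 mxtrace1; lra.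
  rewrite dotvDr dotvNr bil_norm x1 dotvC -/f; lra.
by rewrite dotvDr dotvNr dotvZr -/f => E; lra.
Qed.

End Dimension4.

(** * Structure of proper biharmonic quadratic forms *)

Section ScalarPencil.
Variables (R : realType) (p : nat) (M : 'M[R]_p) (K : R).
Hypothesis symM : M^T = M.
Hypothesis sphereE : forall x, dotv x x = 1 ->
  2 * (dotv (M *m x) (M *m x) - dotv x (M *m x) ^+ 2) =
  (2 - dotv x (M *m x)) * (K - dotv x (M *m x) ^+ 2).

(** Powers of |x|^2 make both sides homogeneous of degree 6, so that the identity applies at the
    non-unit points [u + t v]. *)
Lemma homogeneous_identity x : 0 < dotv x x ->
  2 * (dotv (M *m x) (M *m x) * dotv x x - dotv x (M *m x) ^+ 2) * dotv x x =
  (2 * dotv x x - dotv x (M *m x)) * (K * dotv x x ^+ 2 - dotv x (M *m x) ^+ 2).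
Proof.
move=> x0; have [y y1] : exists2 y, dotv y y = 1 & x = enorm x *: y.
  exists (normalize x); first exact: normalize_sphere.
  by rewrite scalerA divff ?scale1r // /enorm gt_eqF // sqrtr_gt0.
move: (enorm x) => r ->; rewrite -scalemxAr !(dotvZl, dotvZr) y1.
transitivity (r ^+ 6 * (2 * (dotv (M *m y) (M *m y) - dotv y (M *m y) ^+ 2))).
  ring.
by rewrite (sphereE y1); ring.
Qed.

(* On the plane spanned by u and v, at x = u + t v, the identity reads
   g(t)^3 = 0 modulo 1 + t^2, where g(t) = dotv x (M *m x); evaluating at
   t = i gives g(i) = 0. *)
Lemma orthonormal_pair_scalar u v :
  dotv u u = 1 -> dotv v v = 1 -> dotv v u = 0 ->
  dotv u (M *m u) = dotv v (M *m v) /\ dotv u (M *m v) = 0.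
Proof.
move=> u1 v1 vu.
have uMv : dotv v (M *m u) = dotv u (M *m v) by rewrite dotvC dotv_mulmxl symM.
set a := dotv u (M *m u); set b := dotv u (M *m v); set d := dotv v (M *m v).
set m0 := dotv (M *m u) (M *m u); set m1 := dotv (M *m u) (M *m v).
set m2 := dotv (M *m v) (M *m v).
have E (t : R) : 2 * ((m0 + 2 * m1 * t + m2 * t ^+ 2) * (1 + t ^+ 2)
      - (a + 2 * b * t + d * t ^+ 2) ^+ 2) * (1 + t ^+ 2) =
    (2 * (1 + t ^+ 2) - (a + 2 * b * t + d * t ^+ 2)) *
    (K * (1 + t ^+ 2) ^+ 2 - (a + 2 * b * t + d * t ^+ 2) ^+ 2).
  have := @homogeneous_identity (t *: v + u) (dotv_line_gt0 u1 vu t).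
  rewrite dotv_line // v1 mulr1 mulmxDr -scalemxAr !dotv_linE uMv.
  rewrite [dotv (M *m v) (M *m u)]dotvC -/a -/b -/d -/m0 -/m1 -/m2.
  by move=> e; lra.
have e0 := E 0; have e1 := E 1; have e2 := E (-1); have e3 := E 2.
have e4 := E (-2); have e5 := E 3; have e6 := E (-3).
(* Seven values of [t] determine the sextic identity. Here [g(i) = (a - d) + 2 b i]; [re] and [im]
   are the two parts of [g(i)^3], and [n0] is |g(i)|^6 = 0. *)
have re : (a - d) ^+ 3 - 3 * (a - d) * (2 * b) ^+ 2 = 0 by clear E; lra.
have im : 3 * (a - d) ^+ 2 * (2 * b) - (2 * b) ^+ 3 = 0 by clear E; lra.
have n0 : ((a - d) ^+ 2 + (2 * b) ^+ 2) ^+ 3 = 0.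
  transitivity (((a - d) ^+ 3 - 3 * (a - d) * (2 * b) ^+ 2) ^+ 2 +
     (3 * (a - d) ^+ 2 * (2 * b) - (2 * b) ^+ 3) ^+ 2); first ring.
  by rewrite re im expr0n addr0.
move/eqP: n0; rewrite expf_eq0 /= paddr_eq0 ?sqr_ge0 // !expf_eq0 /=.
by rewrite subr_eq0 mulf_eq0 pnatr_eq0 /= => /andP[/eqP -> /eqP ->].
Qed.

(** [orthonormal_pair_scalar] at two coordinate vectors kills the off-diagonal entry and equates the
    two diagonal ones. *)
Lemma pencil_scalar : exists mu, M = mu%:M.
Proof.
have ME i j : M i j = dotv (delta_mx i 0) (M *m delta_mx j 0).
  by rewrite dotv_delta -colE mxE.
have dd (i j : 'I_p) : dotv (delta_mx i 0) (delta_mx j 0) = (i == j)%:R :> R.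
  by rewrite dotv_delta mxE eqxx andbT.
have [p0|p0] := posnP p.
  by exists 0; apply/matrixP => i; have := ltn_ord i; rewrite {2}p0.
exists (M (Ordinal p0) (Ordinal p0)); apply/matrixP => i j; rewrite [RHS]mxE.
have P (k l : 'I_p) : k != l -> M k k = M l l /\ M k l = 0.
  move=> kl; rewrite !ME; apply: orthonormal_pair_scalar.
  - by rewrite dd eqxx.
  - by rewrite dd eqxx.
  - by rewrite dd eq_sym (negPf kl).
have [<-|ij] := eqVneq i j; last by rewrite mulr0n; have [] := P _ _ ij.
rewrite mulr1n; have [<-//|ij] := eqVneq i (Ordinal p0).
by have [] := P _ _ ij.
Qed.

End ScalarPencil.

Section Structure.
Variable R : realType.

Lemma homogeneous2_sym p (f : 'cV[R]_p -> R) : homogeneous2 f ->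
  exists A : 'M[R]_p, A^T = A /\ forall x, f x = dotv x (A *m x).
Proof.
move=> [B fB]; exists (2^-1 *: (B + B^T)); split.
  by rewrite linearZ /= linearD /= trmxK addrC.
move=> x; rewrite -scalemxAl mulmxDl dotvZr dotvDr -dotv_mulmxl [dotv (B *m x) x]dotvC.
have -> : f x = dotv x (B *m x); last by field.
rewrite fB; apply: eq_bigr => i _; rewrite mxE mulr_sumr.
by apply: eq_bigr => j _; ring.
Qed.

(** The norm condition, given on the sphere, extends to all vectors because both sides have degree
    4. *)
Lemma quadratic_form_bil p q (phi : 'cV[R]_p -> 'cV[R]_q) : quadratic_form phi ->
  exists A : 'I_q -> 'M[R]_p,
    [/\ forall i, (A i)^T = A i,
        forall y, dotv (bil A y y) (bil A y y) = dotv y y ^+ 2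
      & forall y, dotv y y = 1 -> phi y = bil A y y].
Proof.
move=> [[F [F2 Fs phiF]] _].
have /choice[A HA] : forall i, exists Ai : 'M[R]_p,
    Ai^T = Ai /\ forall x, F x i 0 = dotv x (Ai *m x).
  by move=> i; apply: homogeneous2_sym.
have FA x : F x = bil A x x.
  by apply/matrixP => i j; rewrite (ord1 j) mxE; have [_ ->] := HA i.
exists A; split.
- by move=> i; have [] := HA i.
- move=> y; have [->|y0] := eqVneq y 0.
    rewrite [bil A 0 0](_ : _ = 0) ?dot0v ?expr0n //.
    by apply/matrixP => i j; rewrite !mxE dot0v.
  have yp : 0 < dotv y y by rewrite lt_def dotv_eq0 y0 dotv_ge0.
  have z1 : dotv (normalize y) (normalize y) = 1 by exact: normalize_sphere.
  have /usphereP := Fs _ ((usphereP _).2 z1).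
  have r2 : enorm y ^+ 2 = dotv y y by rewrite sqr_sqrtr ?ltW.
  rewrite FA /normalize bilZl bilZr !(dotvZl, dotvZr) => e.
  have r0 : enorm y != 0 by rewrite /enorm gt_eqF // sqrtr_gt0.
  rewrite -r2; move: r0 e; move: (enorm y) (dotv _ _) => r w r0 e.
  have -> : w = r ^+ 4 * (r^-1 * (r^-1 * (r^-1 * (r^-1 * w)))) by field.
  by rewrite e; ring.
- by move=> y y1; rewrite -FA; apply: phiF; apply/usphereP.
Qed.

Lemma proper_biharmonic_structure q (phi : 'cV[R]_4 -> 'cV[R]_q) :
  quadratic_form phi -> proper_biharmonic phi ->
  exists (A : 'I_q -> 'M[R]_4) (c : 'cV[R]_q),
    [/\ forall i, (A i)^T = A i, forall i, \tr (A i) = 0, dotv c c = 2^-1,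
        forall x, dotv c (bil A x x) = 0
      & (forall x, dotv (bil A x x) (bil A x x) = 2^-1 * dotv x x ^+ 2) /\
        forall x, dotv x x = 1 -> phi x = bil A x x + c].
Proof.
move=> qphi [bih nharm].
have [A [symA Anorm phiE]] := quadratic_form_bil qphi.
set T := mxtraces A.
have symM := pencil_sym symA T.
have E x : dotv x x = 1 ->
  2 * (dotv (pencil A T *m x) (pencil A T *m x) - dotv x (pencil A T *m x) ^+ 2) =
  (2 - dotv x (pencil A T *m x)) * (dotv T T - dotv x (pencil A T *m x) ^+ 2).
  by move=> x1; rewrite -!(dotv_bil A T x x); apply: (biharmonic_scalar symA Anorm phiE bih).
have [mu Mmu] := pencil_scalar symM E.
have TT : dotv T T = 4 * mu.
  have : \tr (pencil A T) = dotv T T.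
    rewrite /pencil raddf_sum; apply: eq_bigr => i _.
    by rewrite /= mxtraceZ; congr (_ * _); rewrite mxE.
  by rewrite Mmu mxtrace_scalar => <-; rewrite mulr_natl.
have TF x : dotv T (bil A x x) = mu * dotv x x.
  by rewrite dotv_bil Mmu mul_scalar_mx dotvZr.
pose e : 'cV[R]_4 := delta_mx 0 0.
have e1 : dotv e e = 1 by rewrite dotv_delta mxE eqxx.
(* For [M = mu I] the left side of [E] vanishes and f is constantly [mu] on the sphere, while |T|^2
   = 4 mu. *)
have : (2 - mu) * (mu * (4 - mu)) = 0.
  have := E _ e1; rewrite Mmu TT mul_scalar_mx !(dotvZl, dotvZr) e1 => h.
  transitivity ((2 - mu * 1) * (4 * mu - (mu * 1) ^+ 2)); first ring.
  by rewrite -h; ring.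
move/eqP; rewrite !mulf_eq0 => /orP[mu2|/orP[/eqP mu0|mu4]]; last 2 first.
- case: nharm => x /usphereP x1; rewrite (tensionE symA Anorm phiE) //.
  have /eqP : dotv T T = 0 by rewrite TT mu0 mulr0.
  by rewrite dotv_eq0 -/T => /eqP ->; rewrite /tangent_part dot0v scale0r subr0 scaler0.
(* For [mu = 4], |F - T / 4|^2 = 1 - 2 + 1 = 0 on the sphere, against non-constancy. *)
- case: qphi => _ [x [y [/usphereP x1 /usphereP y1 /eqP]]]; case.
  have {}mu4 : mu = 4 by move: mu4; rewrite subr_eq0 => /eqP.
  suff F z : dotv z z = 1 -> phi z = 4^-1 *: T by rewrite !F.
  move=> z1; apply/eqP; rewrite phiE // -subr_eq0 -dotv_eq0.
  rewrite !dotv_linE Anorm [dotv (bil A z z) T]dotvC TF TT z1 mu4; apply/eqP.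
  by field.
have {}mu2 : mu = 2 by move: mu2; rewrite subr_eq0 => /eqP.
(* Subtracting [|x|^2 c] keeps the components homogeneous and makes them traceless, as the identity
   has trace 4. *)
pose c := 4^-1 *: T; pose B i := A i - (c i 0)%:M.
have BE x : bil B x x = bil A x x - dotv x x *: c.
  apply/matrixP => i j; rewrite (ord1 j) !mxE mulmxBl mul_scalar_mx dotvDr dotvNr dotvZr.
  by rewrite !mxE mulrC.
exists B, c; split.
- by move=> i; rewrite /B linearB /= symA tr_scalar_mx.
- by move=> i; rewrite /B linearB /= mxtrace_scalar !mxE -mulr_natl; field.
- by rewrite dotvZl dotvZr TT mu2; field.
- by move=> x; rewrite BE !dotv_linE TF TT mu2; field.
split=> x.
  by rewrite BE !dotv_linE Anorm [dotv (bil A x x) T]dotvC TF TT mu2; field.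
by move=> x1; rewrite BE x1 scale1r subrK phiE.
Qed.

End Structure.

(** * Spectral theorem and polar normal form *)

Section Spectral.
Variable R : realType.

Lemma orthogonal_mxC k (O : 'M[R]_k) : orthogonal_mx O -> O^T *m O = 1%:M.
Proof. exact: mulmx1C. Qed.

Lemma orthogonal_mx_tr k (O : 'M[R]_k) : orthogonal_mx O -> orthogonal_mx O^T.
Proof. by move=> /orthogonal_mxC; rewrite /orthogonal_mx trmxK. Qed.

Lemma orthogonal_mxM k (O P : 'M[R]_k) :
  orthogonal_mx O -> orthogonal_mx P -> orthogonal_mx (O *m P).
Proof.
rewrite /orthogonal_mx => OO PP.
by rewrite trmx_mul -mulmxA (mulmxA P) PP mul1mx.
Qed.

Lemma orthogonal_mx1 k : orthogonal_mx (1%:M : 'M[R]_k).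
Proof. by rewrite /orthogonal_mx trmx1 mulmx1. Qed.

Lemma orthogonal_dotv k (O : 'M[R]_k) u v :
  orthogonal_mx O -> dotv (O *m u) (O *m v) = dotv u v.
Proof. by move=> /orthogonal_mxC OO; rewrite dotv_mulmxl mulmxA OO mul1mx. Qed.

(** A complex eigenvalue [a + i b] makes the real matrix [P = (S - a)^2 + b^2] singular. For a real
    [u] in its kernel, |(S - a) u|^2 + b^2 |u|^2 = 0, hence [S u = a u]. *)
Lemma sym_eigenvector n (S : 'M[R]_n.+1) : S^T = S ->
  exists a (v : 'cV[R]_n.+1), dotv v v = 1 /\ S *m v = a *: v.
Proof.
move=> symS; pose SC := map_mx (real_complex R) S.
have [z /eigenvalueP[w wS w0]] := @eigenvalue_closed _ n.+1 SC isT.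
have [a [b zE]] : exists a b, z = (real_complex R a + 'i * real_complex R b)%R.
  by exists (complex.Re z), (complex.Im z); rewrite [LHS]complexE complexiE.
pose P := (S - a%:M) *m (S - a%:M) + (b ^+ 2)%:M.
have wP : w *m map_mx (real_complex R) P = 0.
  rewrite /P map_mxD map_mxM map_mxB !map_scalar_mx -/SC rmorphXn /=.
  rewrite mulmxDr mulmxA [w *m (SC - _)]mulmxBr wS mul_mx_scalar -scalerBl.
  have -> : z - real_complex R a = 'i * real_complex R b by rewrite zE addrAC subrr add0r.
  rewrite -scalemxAl mulmxBr wS !mul_mx_scalar -scalerBl scalerA -scalerDl.
  have -> : z - real_complex R a = 'i * real_complex R b by rewrite zE addrAC subrr add0r.
  by rewrite -expr2 exprMn sqrCi mulN1r addNr scale0r.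
have /eqP : \det P = 0.
  apply: (fmorph_inj (real_complex R)); rewrite rmorph0 -det_map_mx.
  by apply/eqP/det0P; exists w.
move=> /det0P[v v0 vP].
pose u := v^T; have u0 : u != 0 by rewrite trmx_eq0.
have symD : (S - a%:M)^T = S - a%:M by rewrite linearB /= symS tr_scalar_mx.
have Pu : P *m u = 0.
  have symP : P^T = P by rewrite linearD /= trmx_mul !symD tr_scalar_mx.
  by rewrite -symP -trmx_mul vP trmx0.
have D0 : dotv ((S - a%:M) *m u) ((S - a%:M) *m u) + b ^+ 2 * dotv u u = 0.
  rewrite dotv_mulmxl symD -dotvZr -mul_scalar_mx mulmxA -dotvDr -mulmxDl.
  by rewrite -/P Pu dotv0.
have bu : 0 <= b ^+ 2 * dotv u u by apply: mulr_ge0; [exact: sqr_ge0|exact: dotv_ge0].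
move/eqP: D0; rewrite paddr_eq0 ?dotv_ge0 //.
rewrite dotv_eq0 mulmxBl mul_scalar_mx subr_eq0 => /andP[/eqP Su _].
exists a, (normalize u); split.
  by apply: normalize_sphere; rewrite lt_def dotv_eq0 u0 dotv_ge0.
by rewrite /normalize -scalemxAr Su scalerA mulrC -scalerA.
Qed.

(* The Householder reflection along u - e exchanges e and u. *)
Lemma reflection_to n (e u : 'cV[R]_n) : dotv e e = 1 -> dotv u u = 1 ->
  exists H : 'M[R]_n, [/\ orthogonal_mx H, H^T = H & H *m e = u].
Proof.
move=> e1 u1; have [->|ue] := eqVneq e u.
  by exists 1%:M; rewrite trmx1 mul1mx; split=> //; exact: orthogonal_mx1.
set w := u - e; have w0 : dotv w w != 0 by rewrite dotv_eq0 subr_eq0 eq_sym.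
have wwT : w *m w^T *m (w *m w^T) = dotv w w *: (w *m w^T).
  by rewrite -mulmxA (mulmxA w^T) [w^T *m w]mx11_scalar -dotvE mul_scalar_mx scalemxAr.
have symH : (1%:M - (2 / dotv w w) *: (w *m w^T))^T = 1%:M - (2 / dotv w w) *: (w *m w^T).
  by rewrite linearB /= linearZ /= trmx1 trmx_mul trmxK.
exists (1%:M - (2 / dotv w w) *: (w *m w^T)); split=> //.
  rewrite /orthogonal_mx symH mulmxBl mul1mx mulmxBr mulmx1 -scalemxAl -scalemxAr wwT.
  move: (dotv w w) w0 (w *m w^T) => s s0 N; apply/matrixP => i j; rewrite !mxE.
  by field.
have we : dotv w e = - dotv w w / 2.
  rewrite /w !dotv_linE e1 u1 (dotvC e u); lra.
rewrite mulmxBl mul1mx -scalemxAl -mulmxA [w^T *m e]mx11_scalar -dotvE mul_mx_scalar we.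
rewrite scalerA; have -> : 2 / dotv w w * (- dotv w w / 2) = -1 by field.
by rewrite scaleN1r opprK addrC subrK.
Qed.

(** Induction by deflation: a reflection moves a unit eigenvector to the first coordinate vector,
    and symmetry then splits off a block of size 1. *)
Lemma spectral_sym n (S : 'M[R]_n) : S^T = S ->
  exists (Q : 'M[R]_n) (d : 'rV[R]_n), orthogonal_mx Q /\ S = Q^T *m diag_mx d *m Q.
Proof.
elim: n S => [|n IH] S symS.
  exists 1%:M, 0; split; first exact: orthogonal_mx1.
  by apply/matrixP => -[].
have [a [u [u1 Su]]] := sym_eigenvector symS.
pose e : 'cV[R]_n.+1 := delta_mx 0 0.
have e1 : dotv e e = 1 by rewrite dotv_delta mxE eqxx.
have [H [HH symH He]] := reflection_to e1 u1.
have HH1 : H *m H = 1%:M by rewrite -{2}symH.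
have Hu : H *m u = e by rewrite -He mulmxA HH1 mul1mx.
pose S1 : 'M[R]_(1 + n) := H *m S *m H.
have symS1 : S1^T = S1 by rewrite /S1 !trmx_mul symH symS mulmxA.
have S1e : S1 *m e = a *: e by rewrite -!mulmxA He Su -scalemxAr Hu.
have SE : S = H *m S1 *m H by rewrite /S1 !mulmxA HH1 mul1mx -mulmxA HH1 mulmx1.
clearbody S1.
have colS1 i : S1 i 0 = a * (i == 0)%:R.
  by have := congr1 (fun m : 'cV_n.+1 => m i 0) S1e; rewrite -colE !mxE eqxx andbT.
have symD : (drsubmx S1)^T = drsubmx S1 by rewrite trmx_drsub symS1.
have [Q [d [QQ DE]]] := IH _ symD.
have S1E : S1 = block_mx a%:M 0 0 (drsubmx S1).
  rewrite -[LHS]submxK; congr block_mx.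
  - apply/matrixP => i j; rewrite !ord1 !mxE.
    have -> : lshift n 0 = 0 :> 'I_(1 + n) by exact: val_inj.
    by rewrite colS1 eqxx mulr1.
  - apply/matrixP => i j; rewrite (ord1 i) -symS1 !mxE.
    have -> : lshift n 0 = 0 :> 'I_(1 + n) by exact: val_inj.
    by rewrite colS1 mulr0.
  - apply/matrixP => i j; rewrite (ord1 j) !mxE.
    have -> : lshift n 0 = 0 :> 'I_(1 + n) by exact: val_inj.
    by rewrite colS1 mulr0.
pose Q1 : 'M[R]_(1 + n) := block_mx 1%:M 0 0 Q.
have Q1Q1 : orthogonal_mx Q1.
  rewrite /orthogonal_mx tr_block_mx !trmx0 trmx1 mulmx_block !mul1mx !mulmx0 !mul0mx.
  by rewrite !addr0 !add0r QQ -scalar_mx_block.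
exists (Q1 *m H), (row_mx a%:M d); split; first exact: orthogonal_mxM.
rewrite SE {1}S1E trmx_mul symH -!mulmxA; congr (H *m _).
rewrite !mulmxA; congr (_ *m H).
have DD : diag_mx (row_mx a%:M d) = block_mx a%:M 0 0 (diag_mx d) :> 'M[R]_(1 + n).
  rewrite diag_mx_row; congr block_mx.
  by apply/matrixP => i j; rewrite !ord1 !mxE.
have E : Q1^T *m diag_mx (row_mx a%:M d) *m Q1 = block_mx a%:M 0 0 (drsubmx S1).
  rewrite DD tr_block_mx !trmx0 trmx1 !mulmx_block !mul1mx !mulmx0 !mul0mx.
  by rewrite !mulmx1 !addr0 !add0r mul0mx -DE.
exact: esym E.
Qed.

Lemma sympos_unit n (B : 'M[R]_n) : sympos_mx B -> B \in unitmx.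
Proof.
move=> [symB posB]; rewrite unitmxE unitfE; apply/det0P => -[v v0 vB].
have := posB v^T; rewrite trmx_eq0 => /(_ v0).
by rewrite -{1}symB -trmx_mul vB trmx0 dotv0 ltxx.
Qed.

Lemma sympos_sqrt n (S : 'M[R]_n) : sympos_mx S ->
  exists B : 'M[R]_n, sympos_mx B /\ B *m B = S.
Proof.
move=> [symS posS]; have [Q [d [QQ SE]]] := spectral_sym symS.
have QQC := orthogonal_mxC QQ.
have dE (D : 'rV[R]_n) v : dotv v (Q^T *m diag_mx D *m Q *m v) =
    \sum_i D 0 i * (Q *m v) i 0 ^+ 2.
  rewrite -!mulmxA -dotv_mulmxl /dotv; apply: eq_bigr => i _.
  by rewrite mul_diag_mx [X in _ * X]mxE; ring.
have d0 i : 0 < d 0 i.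
  have : Q^T *m delta_mx i 0 != 0 :> 'cV_n.
    apply/eqP => /(congr1 (mulmx Q)); rewrite mulmxA QQ mul1mx mulmx0.
    move/(congr1 (fun m : 'cV_n => m i 0)); rewrite !mxE !eqxx => /eqP.
    by rewrite oner_eq0.
  move=> /posS; rewrite {1}SE dE mulmxA QQ mul1mx (bigD1 i) //= big1.
    by rewrite addr0 mxE !eqxx expr1n mulr1.
  by move=> j /negPf ji; rewrite mxE ji expr0n mulr0.
pose r := \row_i Num.sqrt (d 0 i).
exists (Q^T *m diag_mx r *m Q); split; last first.
  rewrite SE !mulmxA; congr (_ *m Q); rewrite -!mulmxA (mulmxA Q) QQ mul1mx.
  congr (_ *m _); apply/matrixP => i j; rewrite mul_diag_mx !mxE.
  have [->|_] := eqVneq i j; last by rewrite !mulr0n mulr0.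
  by rewrite !mulr1n -expr2 sqr_sqrtr // ltW.
split; first by rewrite !trmx_mul trmxK tr_diag_mx mulmxA.
move=> v v0; rewrite dE.
have rv i : true -> 0 <= r 0 i * (Q *m v) i 0 ^+ 2.
  by move=> _; rewrite mulr_ge0 ?sqr_ge0 // mxE sqrtr_ge0.
rewrite lt_def sumr_ge0 // andbT; apply/eqP => rv0; move/eqP: v0; apply.
have : Q *m v = 0.
  apply/matrixP => i j; rewrite (ord1 j) [RHS]mxE; apply/eqP.
  have /eqP := psumr_eq0P rv rv0 (erefl true : xpredT i).
  by rewrite mulf_eq0 sqrf_eq0 {1}mxE gt_eqF ?sqrtr_gt0.
by move=> /(congr1 (mulmx Q^T)); rewrite mulmxA QQC mul1mx mulmx0.
Qed.

End Spectral.

Section Assembly.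
Variables (R : realType) (n : nat).

(* Fullness makes [C | c] invertible, so the columns of C are independent, and
   the polar decomposition of C provides V and B. *)
Lemma polar_normal_form (phi : 'cV[R]_4 -> 'cV[R]_(n + 1)) (f : 'cV[R]_4 -> 'cV[R]_n)
    (U : 'M[R]_4) (C : 'M[R]_(n + 1, n)) (c : 'cV[R]_(n + 1)) :
  full_map phi -> orthogonal_mx U -> dotv c c = 2^-1 ->
  (forall x, dotv x x = 1 -> phi (U *m x) = C *m f x + c) ->
  (forall x, dotv x x = 1 -> dotv c (C *m f x) = 0) ->
  exists (V : 'M[R]_(n + 1)) (B : 'M[R]_n),
    [/\ orthogonal_mx V, sympos_mx B
      & forall x, x \in usphere R 4 ->
          V *m phi (U *m x) =
          col_mx ((Num.sqrt 2)^-1 *: (B *m f x)) (const_mx (Num.sqrt 2)^-1)].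
Proof.
move=> full UU cc phiE cCf.
have full0 (w : 'rV[R]_(n + 1)) :
    (forall x, dotv x x = 1 -> w *m (C *m f x + c) = 0) -> w = 0.
  move=> w0; apply/eqP/negPn/negP => wn0; apply: full.
  exists w^T; first by rewrite trmx_eq0.
  move=> y /usphereP y1; rewrite dotvE trmxK.
  have -> : y = U *m (U^T *m y) by rewrite mulmxA UU mul1mx.
  have y2 : dotv (U^T *m y) (U^T *m y) = 1.
    by rewrite orthogonal_dotv //; exact: orthogonal_mx_tr.
  by rewrite phiE // w0 // mxE.
pose N : 'M[R]_(n + 1) := row_mx C c.
have Nunit : N \in unitmx.
  rewrite unitmxE unitfE; apply/det0P => -[w wn0].
  rewrite /N mul_mx_row => /eqP; rewrite row_mx_eq0 => /andP[/eqP wC /eqP wc].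
  move/eqP: wn0; apply; apply: full0 => x x1.
  by rewrite mulmxDr mulmxA wC mul0mx wc addr0.
(* As [N] is invertible, some row [v] has [v C = c^T C] and [v c = 0]; it annihilates every
   [C f(x) + c], so it vanishes by fullness. *)
have cC : c^T *m C = 0.
  set w := c^T *m C.
  pose v := row_mx w (0 : 'rV_1) *m invmx N.
  have vN : v *m N = row_mx w 0 by rewrite mulmxKV.
  move: (vN); rewrite /N mul_mx_row => /eq_row_mx[vC vc].
  have v0 : v = 0.
    apply: full0 => x x1; rewrite mulmxDr mulmxA vC vc addr0 /w -mulmxA.
    by apply/matrixP => i j; rewrite !ord1 -dotvE cCf // mxE.
  by move: vN; rewrite v0 mul0mx -row_mx0 => /eq_row_mx[].
have cCT : C^T *m c = 0 by rewrite -[LHS]trmxK trmx_mul trmxK cC trmx0.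
have posS : sympos_mx (2 *: (C^T *m C)).
  split; first by rewrite linearZ /= trmx_mul trmxK.
  move=> v v0; rewrite -scalemxAl dotvZr -mulmxA -dotv_mulmxl mulr_gt0 //.
  rewrite lt_def dotv_ge0 andbT dotv_eq0; apply: contra v0 => /eqP Cv.
  have Nv : N *m col_mx v 0 = 0 by rewrite mul_row_col Cv mulmx0 addr0.
  have : col_mx v (0 : 'cV_1) = 0 by rewrite -(mulKmx Nunit (col_mx v 0)) Nv mulmx0.
  by move=> /eqP; rewrite col_mx_eq0 => /andP[].
have [B [posB BB]] := sympos_sqrt posS.
have Bunit := sympos_unit posB; have [symB _] := posB.
have symBi : (invmx B)^T = invmx B by rewrite trmx_inv symB.
have CC : C^T *m C = 2^-1 *: (B *m B) by rewrite BB scalerA mulVf ?scale1r.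
have s2 : Num.sqrt 2 * Num.sqrt 2 = 2 :> R by rewrite -expr2 sqr_sqrtr.
have s20 : Num.sqrt 2 != 0 :> R by rewrite gt_eqF // sqrtr_gt0.
pose s := Num.sqrt 2 : R; rewrite -/s in s2 s20 *.
(* The orthonormal polar factor of [s C] is [s C B^-1]; its transpose is completed by [s c^T], a
   unit row since |c|^2 = 1/2. *)
pose V : 'M[R]_(n + 1) := col_mx (s *: (invmx B *m C^T)) (s *: c^T).
have sE : s * 2^-1 = s^-1.
  by apply: (mulfI s20); rewrite mulfV // mulrA s2 mulfV.
exists V, B; split=> //.
  rewrite /orthogonal_mx /V tr_col_mx mul_col_row !linearZ /= !trmx_mul !trmxK symBi.
  rewrite -!scalemxAl !scalerA s2.
  rewrite -!mulmxA (mulmxA C^T C) CC cCT (mulmxA c^T C) cC !mulmx0 mul0mx !scaler0.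
  rewrite -scalemxAl -scalemxAr scalerA mulfV // scale1r -!mulmxA mulmxV // mulmx1.
  rewrite mulVmx // [c^T *m c]mx11_scalar -dotvE cc scale_scalar_mx mulfV //.
  by rewrite -scalar_mx_block.
move=> x /usphereP x1; rewrite phiE // /V mul_col_mx !mulmxDr -!scalemxAl.
rewrite -!mulmxA cCT mulmx0 scaler0 addr0 (mulmxA C^T) CC (mulmxA c^T) cC mul0mx.
rewrite scaler0 add0r -scalemxAl -scalemxAr scalerA -(mulmxA B B) mulKmx // sE.
congr col_mx; apply/matrixP => i j; rewrite !ord1 [c^T *m c]mx11_scalar -dotvE cc !mxE.
by rewrite eqxx mulr1n.
Qed.

End Assembly.

(** * Quaternions and rotations *)

Section SmallIndices.
Variable R : realType.

Lemma sum_ord3 (V : nmodType) (F : 'I_3 -> V) : \sum_i F i = F 0 + F 1 + F 2.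
Proof.
rewrite !big_ord_recr big_ord0 /= add0r.
by congr (F _ + F _ + F _); apply: val_inj.
Qed.

Lemma sum_ord4 (V : nmodType) (F : 'I_4 -> V) :
  \sum_i F i = F 0 + F 1 + F 2 + F 3.
Proof.
rewrite !big_ord_recr big_ord0 /= add0r.
by congr (F _ + F _ + F _ + F _); apply: val_inj.
Qed.

Lemma ord3_case (P : 'I_3 -> Prop) : P 0 -> P 1 -> P 2 -> forall i, P i.
Proof.
move=> P0 P1 P2 [[|[|[|//]]] i3].
- by rewrite (_ : Ordinal i3 = 0) //; exact: val_inj.
- by rewrite (_ : Ordinal i3 = 1) //; exact: val_inj.
- by rewrite (_ : Ordinal i3 = 2) //; exact: val_inj.
Qed.

Lemma ord4_case (P : 'I_4 -> Prop) : P 0 -> P 1 -> P 2 -> P 3 -> forall i, P i.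
Proof.
move=> P0 P1 P2 P3 [[|[|[|[|//]]]] i4].
- by rewrite (_ : Ordinal i4 = 0) //; exact: val_inj.
- by rewrite (_ : Ordinal i4 = 1) //; exact: val_inj.
- by rewrite (_ : Ordinal i4 = 2) //; exact: val_inj.
- by rewrite (_ : Ordinal i4 = 3) //; exact: val_inj.
Qed.

Definition mx_of m n (s : seq (seq R)) : 'M[R]_(m, n) :=
  \matrix_(i, j) (nth [::] s i)`_j.

End SmallIndices.

Section Quaternions.
Variable R : realType.
Implicit Types r x y : 'cV[R]_4.

Definition quat (a b c d : R) : 'cV[R]_4 := col_of 4 [:: a; b; c; d].

Definition left_mul r : 'M[R]_4 :=
  let a := r 0 0 in let b := r 1 0 in let c := r 2 0 in let d := r 3 0 in
  mx_of 4 4 [:: [:: a; - b; - c; - d]; [:: b; a; - d; c];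
                [:: c; d; a; - b]; [:: d; - c; b; a]].

Definition right_mul r : 'M[R]_4 :=
  let a := r 0 0 in let b := r 1 0 in let c := r 2 0 in let d := r 3 0 in
  mx_of 4 4 [:: [:: a; - b; - c; - d]; [:: b; a; d; - c];
                [:: c; - d; a; b]; [:: d; c; - b; a]].

(** Quaternion conjugation; it transposes [qrot], which allows rows and columns to be exchanged. *)
Definition conj_mx : 'M[R]_4 := diag_mx (\row_i (if i == 0 then 1 else -1)).

(* The matrix of y |-> x y x^bar on imaginary quaternions, i.e. |x|^2 times a
   rotation. *)
Definition qrot x : 'M[R]_3 :=
  let a := x 0 0 in let b := x 1 0 in let c := x 2 0 in let d := x 3 0 in
  mx_of 3 3
   [:: [:: a ^+ 2 + b ^+ 2 - c ^+ 2 - d ^+ 2; 2 * (b * c - a * d); 2 * (b * d + a * c)];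
       [:: 2 * (b * c + a * d); a ^+ 2 - b ^+ 2 + c ^+ 2 - d ^+ 2; 2 * (c * d - a * b)];
       [:: 2 * (b * d - a * c); 2 * (c * d + a * b); a ^+ 2 - b ^+ 2 - c ^+ 2 + d ^+ 2]].

Lemma quat_eta x : x = quat (x 0 0) (x 1 0) (x 2 0) (x 3 0).
Proof. by apply/matrixP; elim/ord4_case => j; rewrite (ord1 j) mxE. Qed.

Lemma dotv_quat x y :
  dotv x y = x 0 0 * y 0 0 + x 1 0 * y 1 0 + x 2 0 * y 2 0 + x 3 0 * y 3 0.
Proof. exact: sum_ord4. Qed.

(** Conjugation by [r x] is conjugation by [x] followed by conjugation by [r]. *)
Lemma qrot_left_mul r x : qrot (left_mul r *m x) = qrot r *m qrot x.
Proof.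
apply/matrixP; elim/ord3_case; elim/ord3_case;
  rewrite !mxE sum_ord3 /= !mxE /= !sum_ord4 !mxE /=; ring.
Qed.

Lemma qrot_right_mul r x : qrot (right_mul r *m x) = qrot x *m qrot r.
Proof.
apply/matrixP; elim/ord3_case; elim/ord3_case;
  rewrite !mxE sum_ord3 /= !mxE /= !sum_ord4 !mxE /=; ring.
Qed.

Lemma qrot_conj_mx x : qrot (conj_mx *m x) = (qrot x)^T.
Proof.
apply/matrixP; elim/ord3_case; elim/ord3_case;
  rewrite !mxE /= !sum_ord4 !mxE /= ?mulr1n ?mulr0n; ring.
Qed.

Lemma left_mul_orthogonal r : dotv r r = 1 -> orthogonal_mx (left_mul r).
Proof.
rewrite dotv_quat => r1; apply/matrixP.
elim/ord4_case; elim/ord4_case; rewrite !mxE sum_ord4 !mxE /= ?mulr1n ?mulr0n -?r1; ring.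
Qed.

Lemma right_mul_orthogonal r : dotv r r = 1 -> orthogonal_mx (right_mul r).
Proof.
rewrite dotv_quat => r1; apply/matrixP.
elim/ord4_case; elim/ord4_case; rewrite !mxE sum_ord4 !mxE /= ?mulr1n ?mulr0n -?r1; ring.
Qed.

Lemma conj_mx_orthogonal : orthogonal_mx conj_mx.
Proof.
rewrite /orthogonal_mx /conj_mx tr_diag_mx; apply/matrixP => i j.
rewrite mul_diag_mx !mxE; case: (i == 0); case: (i == j); rewrite ?mulr1n ?mulr0n; ring.
Qed.

Lemma qrot_tr_mul x : qrot x *m (qrot x)^T = (dotv x x ^+ 2)%:M.
Proof.
apply/matrixP; elim/ord3_case; elim/ord3_case;
  rewrite !mxE sum_ord3 /= !mxE /= dotv_quat ?mulr1n ?mulr0n; ring.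
Qed.

Lemma qrot_orthogonal x : dotv x x = 1 -> orthogonal_mx (qrot x).
Proof. by move=> x1; rewrite /orthogonal_mx qrot_tr_mul x1 expr1n. Qed.

End Quaternions.

(** * Gram matrices of families of harmonic quadratic forms *)

Section Isotropic.
Variable R : realType.

Definition mxdot m n (X Y : 'M[R]_(m, n)) : R := \tr (X^T *m Y).

Lemma mxdotE m n (X Y : 'M[R]_(m, n)) : mxdot X Y = \sum_i \sum_j X i j * Y i j.
Proof.
rewrite exchange_big /=; apply: eq_bigr => j _; rewrite mxE.
by apply: eq_bigr => i _; rewrite mxE.
Qed.

Lemma mxdot_mulmx m n (O1 : 'M[R]_m) (O2 : 'M[R]_n) X Y :
  mxdot (O1^T *m X *m O2^T) Y = mxdot X (O1 *m Y *m O2).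
Proof.
by rewrite /mxdot !trmx_mul !trmxK -!mulmxA mxtrace_mulC -!mulmxA !mulmxA.
Qed.

Lemma mxdot_tr m n (X : 'M[R]_(m, n)) (Y : 'M[R]_(n, m)) : mxdot X^T Y = mxdot X Y^T.
Proof. by rewrite /mxdot trmxK -[LHS]mxtrace_tr trmx_mul mxtrace_mulC. Qed.

Lemma mxdot_qrot_quat (X : 'M[R]_3) a b c d : mxdot X (qrot (quat a b c d)) =
  X 0 0 * (a ^+ 2 + b ^+ 2 - c ^+ 2 - d ^+ 2) + X 0 1 * (2 * (b * c - a * d))
  + X 0 2 * (2 * (b * d + a * c)) + X 1 0 * (2 * (b * c + a * d))
  + X 1 1 * (a ^+ 2 - b ^+ 2 + c ^+ 2 - d ^+ 2) + X 1 2 * (2 * (c * d - a * b))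
  + X 2 0 * (2 * (b * d - a * c)) + X 2 1 * (2 * (c * d + a * b))
  + X 2 2 * (a ^+ 2 - b ^+ 2 - c ^+ 2 + d ^+ 2).
Proof. by rewrite mxdotE sum_ord3 !sum_ord3 !mxE /=; ring. Qed.

Variable N : nat.
Implicit Types X : 'I_N -> 'M[R]_3.

(** The map with components [mxdot (X k) (qrot x)] sends the unit sphere into the sphere of squared
    radius [kappa]. *)
Definition isotropic X kappa := forall x : 'cV[R]_4,
  \sum_k mxdot (X k) (qrot x) ^+ 2 = kappa * dotv x x ^+ 2.

Definition gram X a b c d := \sum_k X k a b * X k c d.

Lemma gramC X a b c d : gram X a b c d = gram X c d a b.
Proof. by apply: eq_bigr => k _; rewrite mulrC. Qed.

Lemma isotropic_comb X kappa (s : seq (R * 'cV[R]_4)) : isotropic X kappa ->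
  \sum_k \sum_(p <- s) p.1 * mxdot (X k) (qrot p.2) ^+ 2 =
  kappa * \sum_(p <- s) p.1 * dotv p.2 p.2 ^+ 2.
Proof.
move=> iso; rewrite exchange_big mulr_sumr /=; apply: eq_bigr => p _.
by rewrite -mulr_sumr iso mulrCA.
Qed.

(* All 35 linear conditions on the Gram matrix are permuted by cyclic shifts of
   rows and columns; these are representatives of the orbits. *)
Lemma isotropic_gram00 X kappa : isotropic X kappa ->
  [/\ gram X 0 0 1 1 = 0, gram X 0 1 1 0 = 0,
      gram X 0 1 1 1 = gram X 0 0 1 0, gram X 1 0 1 1 = gram X 0 0 0 1
    & gram X 1 1 1 1 + gram X 0 0 0 0 = gram X 0 1 0 1 + gram X 1 0 1 0].
Proof.
move=> iso.
(* Each list holds weighted sample points. For every [Y], the weighted sum of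
   [mxdot Y (qrot x) ^+ 2] is the quadratic expression in the entries of [Y] whose total over the
   family must vanish, whereas the weighted sum of |x|^4 is 0. *)
pose q (w a b c d : R) := (w, quat a b c d).
pose s1 := [:: q (8^-1) 0 0 0 1; q (- 8^-1) 0 0 1 0;
               q (- 8^-1) 0 1 0 0; q (8^-1) 1 0 0 0].
pose s2 := [:: q (32^-1) 0 1 1 0; q (32^-1) 0 1 (-1) 0;
               q (- 32^-1) 1 0 0 1; q (- 32^-1) 1 0 0 (-1)].
pose s3 := [:: q (- 4^-1) 0 0 0 1; q (- 4^-1) 0 0 1 0; q (16^-1) 0 1 0 0;
  q (16^-1) 1 0 0 0; q (- (3 / 32)) 0 1 1 0; q (96^-1) 0 1 (-1) 0;
  q (- (3 / 32)) 1 0 0 1; q (96^-1) 1 0 0 (-1); q (48^-1) 0 1 2 0; q (48^-1) 1 0 0 2].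
pose s4 := [:: q (4^-1) 0 0 0 1; q (- 4^-1) 0 0 1 0; q (16^-1) 0 1 0 0;
  q (- 16^-1) 1 0 0 0; q (- (3 / 32)) 0 1 1 0; q (96^-1) 0 1 (-1) 0;
  q (3 / 32) 1 0 0 1; q (- 96^-1) 1 0 0 (-1); q (48^-1) 0 1 2 0; q (- 48^-1) 1 0 0 2].
pose s5 := [:: q (4^-1) 0 0 0 1; q (4^-1) 0 0 1 0; q (4^-1) 0 1 0 0; q (4^-1) 1 0 0 0;
  q (- 16^-1) 0 1 1 0; q (- 16^-1) 0 1 (-1) 0; q (- 16^-1) 1 0 0 1;
  q (- 16^-1) 1 0 0 (-1)].
have w0 s : s \in [:: s1; s2; s3; s4; s5] -> \sum_(p <- s) p.1 * dotv p.2 p.2 ^+ 2 = 0.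
  rewrite !inE => /orP[/eqP ->|/or4P[]/eqP ->];
    by rewrite !big_cons big_nil /= !dotv_quat !mxE /=; field.
have comb s F : s \in [:: s1; s2; s3; s4; s5] ->
    (forall k, F k = \sum_(p <- s) p.1 * mxdot (X k) (qrot p.2) ^+ 2) -> \sum_k F k = 0.
  move=> sin FE; rewrite (eq_bigr _ (fun k _ => FE k)) (isotropic_comb _ iso).
  by rewrite w0 // mulr0.
split.
- apply: (comb s1); first by rewrite !inE eqxx ?orbT.
  by move=> k; rewrite !big_cons big_nil /= !mxdot_qrot_quat; field.
- apply: (comb s2); first by rewrite !inE eqxx ?orbT.
  by move=> k; rewrite !big_cons big_nil /= !mxdot_qrot_quat; field.
- apply/eqP; rewrite -subr_eq0 /gram -sumrB; apply/eqP.
  apply: (comb s3); first by rewrite !inE eqxx ?orbT.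
  by move=> k; rewrite !big_cons big_nil /= !mxdot_qrot_quat; field.
- apply/eqP; rewrite -subr_eq0 /gram -sumrB; apply/eqP.
  apply: (comb s4); first by rewrite !inE eqxx ?orbT.
  by move=> k; rewrite !big_cons big_nil /= !mxdot_qrot_quat; field.
- apply/eqP; rewrite -subr_eq0 /gram -!big_split /= -sumrB; apply/eqP.
  apply: (comb s5); first by rewrite !inE eqxx ?orbT.
  by move=> k; rewrite !big_cons big_nil /= !mxdot_qrot_quat; field.
Qed.

End Isotropic.

(** * Shape of the Gram matrix of an isotropic family *)

Section GramForm.
Variables (R : realType) (N : nat).
Implicit Types X : 'I_N -> 'M[R]_3.

(** The map [x |-> r x s] is orthogonal, and it acts on [qrot x] from both sides. *)
Lemma isotropic_mul X kappa (r s : 'cV[R]_4) : dotv r r = 1 -> dotv s s = 1 ->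
  isotropic X kappa -> isotropic (fun k => (qrot r)^T *m X k *m (qrot s)^T) kappa.
Proof.
move=> r1 s1 iso x; under eq_bigr do rewrite mxdot_mulmx -qrot_left_mul -qrot_right_mul.
by rewrite iso !orthogonal_dotv //; [exact: left_mul_orthogonal|exact: right_mul_orthogonal].
Qed.

Lemma ord3_ind (P : 'I_3 -> Prop) : P 0 -> (forall t, P t -> P (1 + t)) -> forall t, P t.
Proof.
move=> P0 PS; apply: ord3_case => //; first by have := PS _ P0; rewrite addr0.
by have := PS _ (PS _ P0); congr P; exact: val_inj.
Qed.

Lemma ord3_neq (a c : 'I_3) : a != c -> c = 1 + a \/ a = 1 + c.
Proof.
move: a c; apply: ord3_case; apply: ord3_case => //= _;
  by [left; exact: val_inj|right; exact: val_inj].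
Qed.

Lemma isotropic_shift X kappa s t : isotropic X kappa ->
  isotropic (fun k => \matrix_(i, j) X k (i + s) (j + t)) kappa.
Proof.
(* Conjugation by [(1 + i + j + k) / 2] permutes the axes cyclically; columns are shifted from the
   other side and take the conjugate quaternion [w']. *)
move=> iso; pose w := quat (2^-1 : R) 2^-1 2^-1 2^-1.
pose w' := quat (2^-1 : R) (- 2^-1) (- 2^-1) (- 2^-1).
pose e := quat (1 : R) 0 0 0.
have w1 : dotv w w = 1 by rewrite dotv_quat !mxE /=; field.
have w'1 : dotv w' w' = 1 by rewrite dotv_quat !mxE /=; field.
have e1 : dotv e e = 1 by rewrite dotv_quat !mxE /=; ring.
have re : qrot e = 1%:M.
  by apply/matrixP; elim/ord3_case; elim/ord3_case; rewrite !mxE /= ?mulr1n ?mulr0n; ring.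
have rw i j : (qrot w)^T i j = (j == i + 1)%:R.
  by move: i j; apply: ord3_case; apply: ord3_case; rewrite !mxE /=; field.
have rw' i j : (qrot w')^T i j = (i == j + 1)%:R.
  by move: i j; apply: ord3_case; apply: ord3_case; rewrite !mxE /=; field.
elim/ord3_ind: s; last first.
  move=> s /(isotropic_mul w1 e1); congr isotropic; apply/funext => k.
  rewrite re trmx1 mulmx1; apply/matrixP => i j; rewrite !mxE (bigD1 (i + 1)) //= rw eqxx.
  rewrite mul1r big1 => [|l /negPf li]; first by rewrite addr0 mxE -[i + 1 + s]addrA.
  by rewrite rw li mul0r.
elim/ord3_ind: t; last first.
  move=> t /(isotropic_mul e1 w'1); congr isotropic; apply/funext => k.
  rewrite re trmx1 mul1mx; apply/matrixP => i j; rewrite !mxE (bigD1 (j + 1)) //= rw' eqxx.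
  rewrite mulr1 big1 => [|l /negPf li]; first by rewrite addr0 mxE -[j + 1 + t]addrA.
  by rewrite rw' li mulr0.
by move: iso; congr isotropic; apply/funext => k; apply/matrixP => i j; rewrite mxE !addr0.
Qed.

(** P is read off column 0, and Q off row 0 with the shared entry subtracted. The shifted relations
    make correlations between rows independent of the column, and conversely. *)
Lemma gram_form X kappa a b c d : isotropic X kappa ->
  gram X a b c d = gram X a 0 c 0 * (b == d)%:R +
    (gram X 0 b 0 d - gram X 0 0 0 0 * (b == d)%:R) * (a == c)%:R.
Proof.
move=> iso.
have sh s t a1 b1 c1 d1 :
    gram (fun k => \matrix_(i, j) X k (i + s) (j + t)) a1 b1 c1 d1 =
    gram X (a1 + s) (b1 + t) (c1 + s) (d1 + t).
  by apply: eq_bigr => k _; rewrite !mxE.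
have rel s t :
  [/\ gram X s t (1 + s) (1 + t) = 0, gram X s (1 + t) (1 + s) t = 0,
      gram X s (1 + t) (1 + s) (1 + t) = gram X s t (1 + s) t,
      gram X (1 + s) t (1 + s) (1 + t) = gram X s t s (1 + t)
    & gram X (1 + s) (1 + t) (1 + s) (1 + t) + gram X s t s t =
      gram X s (1 + t) s (1 + t) + gram X (1 + s) t (1 + s) t].
  by have := isotropic_gram00 (isotropic_shift s t iso); rewrite !sh !add0r.
have row t s : gram X s t (1 + s) t = gram X s 0 (1 + s) 0.
  by elim/ord3_ind: t => // t <-; have [_ _ -> _ _] := rel s t.
have col s t : gram X s t s (1 + t) = gram X 0 t 0 (1 + t).
  by elim/ord3_ind: s => // s <-; have [_ _ _ -> _] := rel s t.
have diag1 s t : gram X (1 + s) t (1 + s) t - gram X s t s t =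
    gram X (1 + s) 0 (1 + s) 0 - gram X s 0 s 0.
  by elim/ord3_ind: t => // t <-; have [_ _ _ _] := rel s t; lra.
have diag s t : gram X s t s t = gram X s 0 s 0 + gram X 0 t 0 t - gram X 0 0 0 0.
  elim/ord3_ind: s => [|s IH]; first by lra.
  by have := diag1 s t; rewrite IH; lra.
have [<-|ac] := eqVneq a c; have [<-|bd] := eqVneq b d.
- by rewrite !mulr1 diag addrA.
- rewrite mulr0 mulr0 subr0 add0r mulr1.
  have [->|->] := ord3_neq bd; first exact: col.
  by rewrite gramC col gramC.
- rewrite mulr1 mulr0 addr0.
  have [->|->] := ord3_neq ac; first exact: row.
  by rewrite gramC row gramC.
- rewrite !mulr0 addr0.
  have [->|->] := ord3_neq ac; have [->|->] := ord3_neq bd.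
  + by have [] := rel a b.
  + by have [] := rel a d.
  + by rewrite gramC; have [] := rel c b.
  + by rewrite gramC; have [] := rel c d.
Qed.

Definition diagonal_gram X (p q : 'I_3 -> R) :=
  forall a b c d, gram X a b c d = (p a + q b) * (a == c)%:R * (b == d)%:R.

(** Contracting the Gram form over columns gives [3 P + (tr Q) I], and over rows [3 Q + (tr P) I]; P
    and Q are thus diagonal when the two contractions are. *)
Lemma diagonal_gramP X kappa (d e : 'rV[R]_3) : isotropic X kappa ->
  \sum_k X k *m (X k)^T = diag_mx d -> \sum_k (X k)^T *m X k = diag_mx e ->
  exists u v, diagonal_gram X (fun a => d 0 a / 3 + u) (fun b => e 0 b / 3 + v).
Proof.
move=> iso dX eX.
have sum1 a c : \sum_b gram X a b c b = d 0 a * (a == c)%:R.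
  have := congr1 (fun M : 'M[R]_3 => M a c) dX; rewrite summxE !mxE mulr_natr => <-.
  by rewrite exchange_big /=; apply: eq_bigr => k _; rewrite mxE; apply: eq_bigr => b _; rewrite mxE.
have sum2 b f : \sum_a gram X a b a f = e 0 b * (b == f)%:R.
  have := congr1 (fun M : 'M[R]_3 => M b f) eX; rewrite summxE !mxE mulr_natr => <-.
  by rewrite exchange_big /=; apply: eq_bigr => k _; rewrite mxE; apply: eq_bigr => a _; rewrite mxE.
pose g a b c f := gram_form a b c f iso.
exists (gram X 0 0 0 0 - d 0 0 / 3), (- (e 0 0 / 3)) => a b c f.
rewrite g.
have P1 : gram X a 0 c 0 = (d 0 a / 3 + (gram X 0 0 0 0 - d 0 0 / 3)) * (a == c)%:R.
  have S : 3 * gram X a 0 c 0 = d 0 a * (a == c)%:R +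
      (3 * gram X 0 0 0 0 - (\sum_b gram X 0 b 0 b)) * (a == c)%:R.
    rewrite -sum1 !sum_ord3 (g a 1 c 1) (g a 2 c 2) !eqxx /=.
    by ring.
  by rewrite sum1 eqxx mulr1 in S; move: S; have [->|_] := eqVneq a c;
    rewrite ?mulr1 ?mulr0 => S; lra.
have Q1 : gram X 0 b 0 f - gram X 0 0 0 0 * (b == f)%:R = (e 0 b / 3 - e 0 0 / 3) * (b == f)%:R.
  have S : 3 * gram X 0 b 0 f = e 0 b * (b == f)%:R +
      (3 * gram X 0 0 0 0 - (\sum_a gram X a 0 a 0)) * (b == f)%:R.
    rewrite -sum2 !sum_ord3 (g 1 b 1 f) (g 2 b 2 f) !eqxx /=.
    by have [bf|bf] := eqVneq b f; rewrite ?bf ?eqxx ?(negPf bf); ring.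
  by rewrite sum2 eqxx mulr1 in S; move: S; have [->|_] := eqVneq b f;
    rewrite ?mulr1 ?mulr0 => S; lra.
by rewrite P1 Q1; ring.
Qed.

End GramForm.

(** * Lifting orthogonal matrices to unit quaternions *)

Section Lift.
Variable R : realType.

(** Half-angle formulas for a cosine [c] and a sine [s]; [c = -1] is set apart because [b] is
    obtained by dividing by [a]. *)
Lemma half_angle (c s : R) : c ^+ 2 + s ^+ 2 = 1 ->
  exists a b, [/\ a ^+ 2 + b ^+ 2 = 1, a ^+ 2 - b ^+ 2 = c & 2 * (a * b) = s].
Proof.
move=> cs; have [c1|c1] := eqVneq c (-1).
  have /eqP : s ^+ 2 = 0 by rewrite c1 in cs; lra.
  by rewrite sqrf_eq0 => /eqP ->; exists 0, 1; split; lra.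
have c2 : -1 < c.
  by rewrite lt_def c1 /=; have := sqr_ge0 s; nra.
pose a := Num.sqrt ((1 + c) / 2).
have aa : a ^+ 2 = (1 + c) / 2 by rewrite sqr_sqrtr //; lra.
have a0 : a != 0 by rewrite gt_eqF // sqrtr_gt0; lra.
have bb : (s / (2 * a)) ^+ 2 = (1 - c) / 2.
  rewrite expr_div_n exprMn aa (_ : s ^+ 2 = (1 - c) * (1 + c)); last by lra.
  by field; lra.
exists a, (s / (2 * a)); rewrite aa bb; split; [lra|lra|by field].
Qed.

Lemma qrot_col0_surj (u : 'cV[R]_3) : dotv u u = 1 ->
  exists r : 'cV[R]_4, dotv r r = 1 /\ forall i, qrot r i 0 = u i 0.
Proof.
rewrite {1}/dotv sum_ord3; set u0 := u 0 0; set u1 := u 1 0; set u2 := u 2 0 => uu.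
have [c1|c1] := eqVneq u0 (-1).
  have z : u1 ^+ 2 + u2 ^+ 2 = 0 by rewrite c1 in uu; lra.
  move/eqP: z; rewrite paddr_eq0 ?sqr_ge0 // !sqrf_eq0 => /andP[/eqP z1 /eqP z2].
  exists (quat 0 0 1 0); split; first by rewrite dotv_quat !mxE /=; ring.
  by apply: ord3_case; rewrite -/u0 -/u1 -/u2 ?c1 ?z1 ?z2 !mxE /=; ring.
have c2 : -1 < u0.
  by rewrite lt_def c1 /=; have := sqr_ge0 u1; have := sqr_ge0 u2; nra.
pose a := Num.sqrt ((1 + u0) / 2).
have aa : a ^+ 2 = (1 + u0) / 2 by rewrite sqr_sqrtr //; lra.
have a0 : a != 0 by rewrite gt_eqF // sqrtr_gt0; lra.
have bb : (- (u2 / (2 * a))) ^+ 2 + (u1 / (2 * a)) ^+ 2 = (1 - u0) / 2.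
  rewrite sqrrN !expr_div_n exprMn aa -mulrDl.
  rewrite (_ : u2 ^+ 2 + u1 ^+ 2 = (1 - u0) * (1 + u0)); last by lra.
  by field; lra.
(* With second coordinate 0, the first column of [qrot] is [(a^2 - c^2 - d^2, 2 a d, - 2 a c)],
   which is solved for [c] and [d]. *)
exists (quat a 0 (- (u2 / (2 * a))) (u1 / (2 * a))); split.
  by rewrite dotv_quat !mxE /= -!expr2 expr0n /= addr0 -addrA bb aa; lra.
apply: ord3_case; rewrite -/u0 -/u1 -/u2 !mxE /=.
- by rewrite -addrA -opprD bb aa; lra.
- by field.
- by field.
Qed.

(** Once the first column is aligned, an orthogonal block of size 2 remains. Its determinant decides
    the sign, as [qrot] only reaches rotations and [-1] reverses orientation in dimension 3. *)
Lemma qrot_lift (O : 'M[R]_3) : orthogonal_mx O ->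
  exists r : 'cV[R]_4, dotv r r = 1 /\ (qrot r = O \/ qrot r = - O).
Proof.
move=> OO; have OOC := orthogonal_mxC OO.
have u1 : dotv (col 0 O) (col 0 O) = 1.
  have := congr1 (fun M : 'M[R]_3 => M 0 0) OOC; rewrite !mxE eqxx => E.
  by rewrite -[RHS]E; apply: eq_bigr => i _; rewrite !mxE.
have [r1 [r11 r1u]] := qrot_col0_surj u1.
pose O1 := (qrot r1)^T *m O.
have OE : O = qrot r1 *m O1 by rewrite mulmxA qrot_orthogonal // mul1mx.
have O1O1 : orthogonal_mx O1.
  by apply: orthogonal_mxM => //; apply: orthogonal_mx_tr; exact: qrot_orthogonal.
have c0 i : O1 i 0 = (i == 0)%:R.
  have := congr1 (fun M : 'M[R]_3 => M i 0) (orthogonal_mxC (qrot_orthogonal r11)).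
  rewrite !mxE => <-; apply: eq_bigr => j _; rewrite r1u !mxE //.
clearbody O1.
have rw i j : \sum_k O1 i k * O1 j k = (i == j)%:R.
  have := congr1 (fun M : 'M[R]_3 => M i j) O1O1; rewrite !mxE => <-.
  by apply: eq_bigr => k _; rewrite mxE.
have cl i j : \sum_k O1 k i * O1 k j = (i == j)%:R.
  have := congr1 (fun M : 'M[R]_3 => M i j) (orthogonal_mxC O1O1); rewrite !mxE => <-.
  by apply: eq_bigr => k _; rewrite mxE.
have := rw 0 0; rewrite sum_ord3 c0 /= => e00.
have z : O1 0 1 ^+ 2 + O1 0 2 ^+ 2 = 0 by lra.
move/eqP: z; rewrite paddr_eq0 ?sqr_ge0 // !sqrf_eq0 => /andP[/eqP z1 /eqP z2].
have := cl 1 1; have := cl 2 2; have := cl 1 2; rewrite !sum_ord3 z1 z2 /=.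
set c := O1 1 1; set s := O1 2 1; set x := O1 1 2; set y := O1 2 2.
rewrite !mul0r !add0r => cxsy xy cs.
(* The determinant of the block; orthogonality gives [(x, y) = e (- s, c)]. *)
pose e := c * y - s * x.
have xE : x = - e * s.
  transitivity ((c * c + s * s) * x - c * (c * x + s * y)); last by rewrite /e; ring.
  by rewrite cs cxsy; ring.
have yE : y = e * c.
  transitivity ((c * c + s * s) * y - s * (c * x + s * y)); last by rewrite /e; ring.
  by rewrite cs cxsy; ring.
have ee : e ^+ 2 = 1.
  transitivity ((c * c + s * s) * (x * x + y * y) - (c * x + s * y) ^+ 2).
    by rewrite /e; ring.
  by rewrite cs cxsy xy; ring.
have O1E (M : 'M[R]_3) t : M 0 0 = t -> M 0 1 = 0 -> M 0 2 = 0 -> M 1 0 = 0 -> M 2 0 = 0 ->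
   M 1 1 = t * c -> M 2 1 = t * s -> M 1 2 = t * x -> M 2 2 = t * y -> M = t *: O1.
  move=> *; apply/matrixP; elim/ord3_case; elim/ord3_case; rewrite mxE ?c0 ?z1 ?z2 /=;
    rewrite ?mulr1 ?mulr0 //.
move/eqP: ee; rewrite sqrf_eq1 => /orP[]/eqP e1.
  have [|a [b [ab1 ab2 ab3]]] := @half_angle c s; first by rewrite !expr2.
  exists (left_mul r1 *m quat a b 0 0); split.
    rewrite orthogonal_dotv; last exact: left_mul_orthogonal.
    by rewrite dotv_quat !mxE /=; lra.
  left; rewrite qrot_left_mul OE; congr (_ *m _); rewrite -[RHS]scale1r.
  by apply: O1E; rewrite ?xE ?yE ?e1 !mxE /=; lra.
(* For [e = -1] the rotation [- O1] reverses the first axis, so it is a half turn about a vector in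
   the plane of [j] and [k]. *)
have [|a [b [ab1 ab2 ab3]]] := @half_angle (- c) (- s); first by rewrite !sqrrN !expr2.
exists (left_mul r1 *m quat 0 0 a b); split.
  rewrite orthogonal_dotv; last exact: left_mul_orthogonal.
  by rewrite dotv_quat !mxE /=; lra.
right; rewrite qrot_left_mul OE -mulmxN; congr (_ *m _); rewrite -scaleN1r.
by apply: O1E; rewrite ?xE ?yE ?e1 !mxE /=; lra.
Qed.

End Lift.

(** * Diagonalising the row and column forms *)

Section CanonicalFrame.
Variable R : realType.

(* Up to a permutation, the minimum of d is attained at 0 only, at 1 and 2
   only, or everywhere. *)
Definition min_pattern (d : 'I_3 -> R) : Prop :=
  [\/ d 0 < d 1 /\ d 0 < d 2, d 1 = d 2 /\ d 1 < d 0 | d 0 = d 1 /\ d 0 = d 2].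

Lemma min_pattern_perm (d : 'I_3 -> R) : exists s : {perm 'I_3}, min_pattern (d \o s).
Proof.
have s12 : tperm (0 : 'I_3) 1 2 = 2 by rewrite tpermD.
have s21 : tperm (0 : 'I_3) 2 1 = 1 by rewrite tpermD.
have P1 : min_pattern d -> exists s : {perm 'I_3}, min_pattern (d \o s).
  by exists 1%g; rewrite /min_pattern /= !perm1.
have P2 : min_pattern (fun i => if i == 0 then d 1 else if i == 1 then d 0 else d 2) ->
    exists s : {perm 'I_3}, min_pattern (d \o s).
  by exists (tperm 0 1); rewrite /min_pattern /= tpermL tpermR s12.
have P3 : min_pattern (fun i => if i == 0 then d 2 else if i == 1 then d 1 else d 0) ->
    exists s : {perm 'I_3}, min_pattern (d \o s).
  by exists (tperm 0 2); rewrite /min_pattern /= tpermL tpermR s21.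
have [c01|c01|c01] := ltgtP (d 0) (d 1); have [c02|c02|c02] := ltgtP (d 0) (d 2).
- by apply: P1; constructor 1.
- apply: P3; constructor 1 => /=; split; lra.
- apply: P2; constructor 2 => /=; split; lra.
- apply: P2; constructor 1 => /=; split; lra.
- have [c12|c12|c12] := ltgtP (d 1) (d 2).
  + apply: P2; constructor 1 => /=; split; lra.
  + apply: P3; constructor 1 => /=; split; lra.
  + apply: P1; constructor 2 => /=; split; lra.
- apply: P2; constructor 1 => /=; split; lra.
- apply: P3; constructor 2 => /=; split; lra.
- apply: P3; constructor 1 => /=; split; lra.
- apply: P1; constructor 3 => /=; split; lra.
Qed.

Lemma spectral_min_pattern (S : 'M[R]_3) : S^T = S ->
  exists (O : 'M[R]_3) (d : 'rV[R]_3),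
    [/\ orthogonal_mx O, S = O^T *m diag_mx d *m O & min_pattern (d 0)].
Proof.
move=> /spectral_sym[Q [d [QQ SE]]].
have [s ds] := min_pattern_perm (d 0).
exists (row_perm s Q), (\row_i d 0 (s i)); split.
- apply/matrixP => i j; have := congr1 (fun M : 'M[R]_3 => M (s i) (s j)) QQ.
  rewrite !mxE (inj_eq perm_inj) => <-; apply: eq_bigr => k _; rewrite !mxE //.
- apply/matrixP => i j; rewrite SE -!mulmxA !mxE (reindex_inj (@perm_inj _ s)) /=.
  by apply: eq_bigr => k _; rewrite !mul_diag_mx !mxE.
- by move: ds; rewrite /min_pattern /= !mxE.
Qed.

(** A rotation on the left conjugates the sum of the [X X^T] and one on the right that of the
    [X^T X], so both are diagonalised independently. *)
Lemma canonical_frame N (X : 'I_N -> 'M[R]_3) kappa : isotropic X kappa ->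
  exists (r s : 'cV[R]_4) (p q : 'I_3 -> R),
    [/\ dotv r r = 1, dotv s s = 1,
        diagonal_gram (fun k => (qrot r)^T *m X k *m (qrot s)^T) p q,
        min_pattern p & min_pattern q].
Proof.
move=> iso.
have sym1 : (\sum_k X k *m (X k)^T)^T = \sum_k X k *m (X k)^T.
  by rewrite raddf_sum /=; apply: eq_bigr => k _; rewrite trmx_mul trmxK.
have sym2 : (\sum_k (X k)^T *m X k)^T = \sum_k (X k)^T *m X k.
  by rewrite raddf_sum /=; apply: eq_bigr => k _; rewrite trmx_mul trmxK.
have [W1 [d [OO1 SE1 pd]]] := spectral_min_pattern sym1.
have [W2 [e [OO2 SE2 pe]]] := spectral_min_pattern sym2.
(* The signs left open by [qrot_lift] cancel, because the lifts enter by conjugation. *)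
have [r [r1 rO]] := qrot_lift (orthogonal_mx_tr OO1).
have [s [s1 sO]] := qrot_lift OO2.
have rr := qrot_orthogonal r1; have ss := orthogonal_mxC (qrot_orthogonal s1).
have conjr (M : 'M[R]_3) : (qrot r)^T *m M *m qrot r = W1 *m M *m W1^T.
  by case: rO => ->; rewrite ?linearN /= ?trmxK ?mulNmx ?mulmxN ?opprK.
have conjs (M : 'M[R]_3) : qrot s *m M *m (qrot s)^T = W2 *m M *m W2^T.
  by case: sO => ->; rewrite ?linearN /= ?mulNmx ?mulmxN ?opprK.
pose Y k := (qrot r)^T *m X k *m (qrot s)^T.
have isoY : isotropic Y kappa by exact: isotropic_mul.
have Y1 : \sum_k Y k *m (Y k)^T = diag_mx d.
  transitivity ((qrot r)^T *m (\sum_k X k *m (X k)^T) *m qrot r).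
    rewrite mulmx_sumr mulmx_suml; apply: eq_bigr => k _.
    by rewrite /Y !trmx_mul !trmxK -!mulmxA (mulmxA (qrot s)^T) ss mul1mx.
  by rewrite conjr SE1 !mulmxA OO1 mul1mx -mulmxA OO1 mulmx1.
have Y2 : \sum_k (Y k)^T *m Y k = diag_mx e.
  transitivity (qrot s *m (\sum_k (X k)^T *m X k) *m (qrot s)^T).
    rewrite mulmx_sumr mulmx_suml; apply: eq_bigr => k _.
    by rewrite /Y !trmx_mul !trmxK -!mulmxA (mulmxA (qrot r)) rr mul1mx.
  by rewrite conjs SE2 !mulmxA OO2 mul1mx -mulmxA OO2 mulmx1.
have [u [v diagY]] := diagonal_gramP isoY Y1 Y2.
exists r, s, (fun a => d 0 a / 3 + u), (fun b => e 0 b / 3 + v).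
have pat (f : 'rV[R]_3) w : min_pattern (f 0) -> min_pattern (fun a => f 0 a / 3 + w).
  by case=> -[f1 f2]; [constructor 1|constructor 2|constructor 3]; split; lra.
by split=> //; exact: pat.
Qed.

End CanonicalFrame.

(** * Harmonic quadratic forms on four variables *)

Section HarmonicQuadratics.
Variable R : realType.

(** Both sides have dimension 9, and the witness comes from comparing coefficients: each pair of
    transposed entries of [X] solves for the coefficients of two complementary products, such as
    [x0 x3] and [x1 x2]. *)
Lemma traceless_qrot (A : 'M[R]_4) : A^T = A -> \tr A = 0 ->
  exists X : 'M[R]_3, forall x, dotv x (A *m x) = mxdot X (qrot x).
Proof.
move=> symA trA.
have sA i j : A i j = A j i by rewrite -{1}symA mxE.
have a0 : A 0 0 = - (A 1 1 + A 2 2 + A 3 3).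
  by move: trA; rewrite /mxtrace sum_ord4; lra.
exists (mx_of 3 3
  [:: [:: (A 0 0 + A 1 1 - A 2 2 - A 3 3) / 4; (A 1 2 - A 0 3) / 2; (A 1 3 + A 0 2) / 2];
      [:: (A 1 2 + A 0 3) / 2; (A 0 0 - A 1 1 + A 2 2 - A 3 3) / 4; (A 2 3 - A 0 1) / 2];
      [:: (A 1 3 - A 0 2) / 2; (A 2 3 + A 0 1) / 2; (A 0 0 - A 1 1 - A 2 2 + A 3 3) / 4]]).
move=> x; rewrite dotv_quat !mxE !sum_ord4 [x in RHS]quat_eta mxdot_qrot_quat !mxE /=.
rewrite (sA 1 0) (sA 2 0) (sA 3 0) (sA 2 1) (sA 3 1) (sA 3 2) a0.
by field.
Qed.

(** A quadratic form is determined by its values at coordinate vectors and their pairwise sums, and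
    the nine entries of [qrot] are independent. *)
Lemma qrot_separates (Y : 'M[R]_3) : (forall x, mxdot Y (qrot x) = 0) -> Y = 0.
Proof.
move=> Y0; have E a b c d := Y0 (quat a b c d).
have e1 := E 1 0 0 0; have e2 := E 0 1 0 0; have e3 := E 0 0 1 0; have e4 := E 0 0 0 1.
have e5 := E 1 1 0 0; have e6 := E 1 0 1 0; have e7 := E 1 0 0 1.
have e8 := E 0 1 1 0; have e9 := E 0 1 0 1; have e10 := E 0 0 1 1.
rewrite !mxdot_qrot_quat in e1 e2 e3 e4 e5 e6 e7 e8 e9 e10.
clear E; apply/matrixP; elim/ord3_case; elim/ord3_case; rewrite [RHS]mxE.
- by clear e5 e6 e7 e8 e9 e10; lra.
- by clear e5 e6 e9 e10; lra.
- by clear e5 e7 e8 e10; lra.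
- by clear e5 e6 e9 e10; lra.
- by clear e5 e6 e7 e8 e9 e10; lra.
- by clear e6 e7 e8 e9; lra.
- by clear e5 e7 e8 e10; lra.
- by clear e6 e7 e8 e9; lra.
- by clear e5 e6 e7 e8 e9 e10; lra.
Qed.

Definition imag_unit (a : 'I_3) : 'cV[R]_4 :=
  quat 0 (a == 0)%:R (a == 1)%:R (a == 2)%:R.

Lemma left_mulE (r x : 'cV[R]_4) : left_mul r *m x = quat
  (r 0 0 * x 0 0 - r 1 0 * x 1 0 - r 2 0 * x 2 0 - r 3 0 * x 3 0)
  (r 1 0 * x 0 0 + r 0 0 * x 1 0 - r 3 0 * x 2 0 + r 2 0 * x 3 0)
  (r 2 0 * x 0 0 + r 3 0 * x 1 0 + r 0 0 * x 2 0 - r 1 0 * x 3 0)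
  (r 3 0 * x 0 0 - r 2 0 * x 1 0 + r 1 0 * x 2 0 + r 0 0 * x 3 0).
Proof.
by apply/matrixP; elim/ord4_case => j; rewrite (ord1 j) !mxE sum_ord4 !mxE /=; ring.
Qed.

Lemma right_mulE (r x : 'cV[R]_4) : right_mul r *m x = quat
  (r 0 0 * x 0 0 - r 1 0 * x 1 0 - r 2 0 * x 2 0 - r 3 0 * x 3 0)
  (r 1 0 * x 0 0 + r 0 0 * x 1 0 + r 3 0 * x 2 0 - r 2 0 * x 3 0)
  (r 2 0 * x 0 0 - r 3 0 * x 1 0 + r 0 0 * x 2 0 + r 1 0 * x 3 0)
  (r 3 0 * x 0 0 + r 2 0 * x 1 0 - r 1 0 * x 2 0 + r 0 0 * x 3 0).
Proof.
by apply/matrixP; elim/ord4_case => j; rewrite (ord1 j) !mxE sum_ord4 !mxE /=; ring.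
Qed.

(* The (a, b) entry of the rotation is <a-th unit, x e_b x^bar>, and right
   multiplication by x is isometric up to the factor |x|. *)
Lemma qrot_entry (x : 'cV[R]_4) (a b : 'I_3) :
  qrot x a b = dotv x (((left_mul (imag_unit a))^T *m right_mul (imag_unit b)) *m x).
Proof.
rewrite -mulmxA -dotv_mulmxl left_mulE right_mulE dotv_quat.
rewrite /imag_unit ![quat _ _ _ _ _ _]mxE /=.
move: a b; apply: ord3_case; apply: ord3_case; rewrite !mxE /=; ring.
Qed.

(** At the four basis quaternions [qrot] is the identity and the three half turns about the axes,
    whose sum is 0. *)
Lemma trace_left_right (a b : 'I_3) :
  \tr ((left_mul (imag_unit a))^T *m right_mul (imag_unit b)) = 0 :> R.
Proof.
transitivity (\sum_i qrot (delta_mx i 0 : 'cV[R]_4) a b).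
  by apply: eq_bigr => i _; rewrite qrot_entry dotv_delta -colE [RHS]mxE.
rewrite sum_ord4; move: a b; apply: ord3_case; apply: ord3_case; rewrite !mxE /=; ring.
Qed.

Lemma is_derive_coord p (x v : 'cV[R]_p) i : is_derive x v (fun y : 'cV[R]_p => y i 0) (v i 0).
Proof.
have d : derivable (@id 'cV[R]_p) x v by exact: derivable_id.
have [+ _] := derivable_mxP (@id 'cV[R]_p) x v => /(_ d i 0) di.
apply: DeriveDef => //; have := derive_mx d; rewrite derive_id.
by move=> /(congr1 (fun m : 'cV[R]_p => m i 0)); rewrite mxE.
Qed.

Lemma is_derive_linear p (x v w : 'cV[R]_p) : is_derive x v (fun y => dotv w y) (dotv w v).
Proof.
have -> : (fun y => dotv w y) = \sum_i (w i 0 \*: (fun y : 'cV[R]_p => y i 0)).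
  by apply/funext => y; rewrite fct_sumE.
by apply: is_derive_sum => i; apply: is_deriveZ; exact: is_derive_coord.
Qed.

Lemma is_derive_quadratic p (A : 'M[R]_p) (x v : 'cV[R]_p) :
  is_derive x v (fun y => dotv y (A *m y)) (dotv ((A + A^T) *m v) x).
Proof.
have -> : (fun y => dotv y (A *m y)) =
    \sum_i ((fun y : 'cV[R]_p => y i 0) * (fun y => dotv (row i A)^T y)).
  apply/funext => y; rewrite fct_sumE; apply: eq_bigr => i _.
  by rewrite mxE; congr (_ * _); apply: eq_bigr => j _; rewrite !mxE.
have -> : dotv ((A + A^T) *m v) x =
    \sum_i (x i 0 *: dotv (row i A)^T v + dotv (row i A)^T x *: v i 0).
  rewrite big_split /= mulmxDl dotvDl; congr (_ + _).
    rewrite dotvC; apply: eq_bigr => i _; congr (_ * _).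
    by rewrite mxE; apply: eq_bigr => j _; rewrite !mxE.
  rewrite dotv_mulmxl trmxK dotvC; apply: eq_bigr => i _; congr (_ * _).
  by rewrite mxE; apply: eq_bigr => j _; rewrite !mxE.
apply: is_derive_sum => i; apply: is_deriveM; first exact: is_derive_coord.
exact: is_derive_linear.
Qed.

Lemma laplacian_quadratic p (A : 'M[R]_p) x :
  laplacian (fun y => dotv y (A *m y)) x = 2 * \tr A.
Proof.
rewrite /laplacian mulr_sumr; apply: eq_bigr => i _.
have -> : (fun y => 'D_(delta_mx i 0) (fun y0 => dotv y0 (A *m y0)) y) =
    (fun y => dotv ((A + A^T) *m delta_mx i 0) y).
  by apply/funext => y; have [_ ->] := is_derive_quadratic A y (delta_mx i 0).
have [_ ->] := is_derive_linear x (delta_mx i 0) ((A + A^T) *m delta_mx i 0).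
by rewrite dotvC dotv_delta -colE !mxE; ring.
Qed.

(** This brings the entries of [qrot] within the spanning property of a standard minimal
    immersion. *)
Lemma qrot_harmonic (a b : 'I_3) : quadratic_harmonic (fun x : 'cV[R]_4 => qrot x a b).
Proof.
exists (fun x => qrot x a b); split=> //.
  exists ((left_mul (imag_unit a))^T *m right_mul (imag_unit b)) => x.
  rewrite qrot_entry; apply: eq_bigr => i _; rewrite mxE mulr_sumr.
  by apply: eq_bigr => j _; ring.
move=> x; have -> : (fun x : 'cV[R]_4 => qrot x a b) = fun y =>
  dotv y (((left_mul (imag_unit a))^T *m right_mul (imag_unit b)) *m y).
  by apply/funext => y; exact: qrot_entry.
by rewrite laplacian_quadratic trace_left_right mulr0.
Qed.

End HarmonicQuadratics.

(** * Supports and classification *)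

Section Support.
Variables (R : realType) (n : nat).
Variables (phi : 'cV[R]_4 -> 'cV[R]_(n + 1)) (c : 'cV[R]_(n + 1)).
Implicit Types (X : 'I_(n + 1) -> 'M[R]_3) (s : seq ('I_3 * 'I_3)).

Definition supported_on (p q : 'I_3 -> R) s := forall a b,
  ((a, b) \in s -> 0 < p a + q b) /\ ((a, b) \notin s -> p a + q b = 0).

(** The third clause is the orthogonality of the harmonic part to [c], stated on matrices. *)
Definition adapted (U : 'M[R]_4) X p q :=
  [/\ orthogonal_mx U,
      forall x, dotv x x = 1 -> phi (U *m x) = \col_k mxdot (X k) (qrot x) + c,
      \sum_k c k 0 *: X k = 0
    & diagonal_gram X p q].

(** Precomposition with quaternion conjugation; zero rectangles then matter only up to
    transposition. *)
Lemma adapted_tr U X p q : adapted U X p q ->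
  adapted (U *m conj_mx R) (fun k => (X k)^T) q p.
Proof.
move=> [UU phiE cX gX]; split.
- by apply: orthogonal_mxM => //; exact: conj_mx_orthogonal.
- move=> x x1; rewrite -mulmxA phiE; last first.
    by rewrite orthogonal_dotv //; exact: conj_mx_orthogonal.
  by congr (_ + _); apply/matrixP => k j; rewrite !mxE mxdot_tr qrot_conj_mx.
- transitivity ((\sum_k c k 0 *: X k)^T); last by rewrite cX trmx0.
  by rewrite raddf_sum /=; apply: eq_bigr => k _; rewrite linearZ.
- move=> a b d e; have <- : gram X b a e d = gram (fun k => (X k)^T) a b d e.
    by apply: eq_bigr => k _; rewrite !mxE.
  by rewrite gX addrC -!mulrA [_%:R * _]mulrC.
Qed.

Definition support_mx X s m : 'M[R]_(n + 1, m) :=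
  \matrix_(k, i) X k (nth (0, 0) s i).1 (nth (0, 0) s i).2.

Definition support_vec s m (x : 'cV[R]_4) : 'cV[R]_m :=
  \col_i qrot x (nth (0, 0) s i).1 (nth (0, 0) s i).2.

Lemma support_mx_orth U X p q (s : seq ('I_3 * 'I_3)) m : adapted U X p q ->
  c^T *m support_mx X s m = 0.
Proof.
move=> [_ _ cX _]; apply/matrixP => i j; rewrite (ord1 i) mxE [RHS]mxE.
have := congr1 (fun M : 'M[R]_3 => M (nth (0, 0) s j).1 (nth (0, 0) s j).2) cX.
rewrite summxE [RHS]mxE => cX0; rewrite -[RHS]cX0.
by apply: eq_bigr => k _; rewrite [RHS]mxE [support_mx _ _ _ _ _]mxE [c^T _ _]mxE.
Qed.

Section WithSupport.
Variables (U : 'M[R]_4) (X : 'I_(n + 1) -> 'M[R]_3) (p q : 'I_3 -> R).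
Variables (s : seq ('I_3 * 'I_3)) (m : nat).
Hypotheses (sz : size s = m) (us : uniq s).
Hypotheses (aX : adapted U X p q) (supp : supported_on p q s).
Hypotheses (full : full_map phi) (cc : dotv c c = 2^-1).

Let pos (i : 'I_m) := nth (0, 0) s i.

(** Outside the support the sum over [k] of the squares [X k a b ^+ 2] is [p a + q b = 0], so every
    such entry vanishes. *)
Lemma support_mxE x : dotv x x = 1 ->
  phi (U *m x) = support_mx X s m *m support_vec s m x + c.
Proof.
move=> x1; have [_ -> // _ gX] := aX; congr (_ + _); apply/matrixP => k j.
rewrite mxE [RHS]mxE mxdotE pair_big /=.
have X0 a b : (a, b) \notin s -> X k a b = 0.
  move=> ab; have := gX a b a b; rewrite !eqxx !mulr1 (supp a b).2 // /gram => g0.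
  have nn l : true -> 0 <= X l a b * X l a b by rewrite -expr2 sqr_ge0.
  by have /eqP := psumr_eq0P nn g0 (erefl true : xpredT k); rewrite mulf_eq0 orbb => /eqP.
rewrite (bigID (fun ab => ab \in s)) /= [X in _ + X]big1 ?addr0; last first.
  by move=> [a b] /= /X0 ->; rewrite mul0r.
rewrite -big_uniq //= (big_nth (0, 0)) big_mkord sz.
by apply: eq_bigr => i _; rewrite [support_mx _ _ _ _ _]mxE [support_vec _ _ _ _ _]mxE.
Qed.

Lemma support_gram : (support_mx X s m)^T *m support_mx X s m =
  diag_mx (\row_i (p (pos i).1 + q (pos i).2)).
Proof.
have [_ _ _ gX] := aX; apply/matrixP => i j; rewrite !mxE.
transitivity (gram X (pos i).1 (pos i).2 (pos j).1 (pos j).2).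
  by apply: eq_bigr => k _; rewrite !mxE.
rewrite gX; have [<-|ij] := eqVneq i j; first by rewrite !eqxx !mulr1.
have : pos i != pos j by rewrite nth_uniq ?sz.
rewrite mulr0n -mulrA -natrM mulnb -xpair_eqE -!surjective_pairing => /negPf ->.
by rewrite mulr0.
Qed.

(** The matrix [[support_mx | c]] has full column rank, its Gram matrix being diagonal with positive
    entries, and full row rank by fullness; so it is square. *)
Lemma support_size : n = m.
Proof.
have [UU _ _ _] := aX; have cC := support_mx_orth s m aX.
have Cc : (support_mx X s m)^T *m c = 0 by rewrite -[LHS]trmxK trmx_mul trmxK cC trmx0.
pose M := row_mx (support_mx X s m) c.
have MM : M^T *m M = block_mx (diag_mx (\row_i (p (pos i).1 + q (pos i).2))) 0 0 (2^-1)%:M.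
  rewrite tr_row_mx mul_col_row support_gram cC Cc; congr block_mx.
  by rewrite [LHS]mx11_scalar -dotvE cc.
have free : \rank M = (m + 1)%N.
  apply/eqP; rewrite eqn_leq rank_leq_col /=.
  apply: leq_trans (mxrankM_maxr M^T M); rewrite MM mxrank_unit //.
  rewrite unitmxE det_ublock det_scalar1 det_diag unitfE mulf_neq0 ?invr_eq0 ?pnatr_eq0 //.
  rewrite prodf_seq_neq0; apply/allP => i _ /=; rewrite mxE gt_eqF //.
  apply: (supp _ _).1; rewrite -surjective_pairing mem_nth // sz.
  exact: ltn_ord.
have frow : \rank M = (n + 1)%N.
  apply/eqP; apply/(@row_freeP _ _ _ M)/row_freeP.
  apply/inj_row_free => w wM; apply/eqP/negPn/negP => w0; apply: full.
  exists w^T; first by rewrite trmx_eq0.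
  move: wM; rewrite mul_mx_row => /eqP; rewrite row_mx_eq0 => /andP[/eqP wC /eqP wc].
  move=> y /usphereP y1; rewrite dotvE trmxK.
  have -> : y = U *m (U^T *m y) by rewrite mulmxA UU mul1mx.
  rewrite support_mxE; last by rewrite orthogonal_dotv //; exact: orthogonal_mx_tr.
  by rewrite mulmxDr mulmxA wC wc mul0mx addr0 mxE.
by apply/eqP; rewrite -(eqn_add2r 1) -free frow.
Qed.

End WithSupport.

(** Reduces the normal form to writing the entries of [qrot] on the support linearly in the model
    [f]. *)
Lemma normal_form_of_support U X p q (s : seq ('I_3 * 'I_3)) (D : 'M[R]_n) (f : 'cV[R]_4 -> 'cV[R]_n) :
  size s = n -> uniq s -> adapted U X p q -> supported_on p q s ->
  full_map phi -> dotv c c = 2^-1 ->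
  (forall x, dotv x x = 1 -> support_vec s n x = D *m f x) ->
  exists (U : 'M[R]_4) (V : 'M[R]_(n + 1)) (B : 'M[R]_n),
    [/\ orthogonal_mx U, orthogonal_mx V, sympos_mx B
      & forall x, x \in usphere R 4 ->
          V *m phi (U *m x) =
          col_mx ((Num.sqrt 2)^-1 *: (B *m f x)) (const_mx (Num.sqrt 2)^-1)].
Proof.
move=> sz us aX supp full cc sD; have [UU _ _ _] := aX.
have phiE x : dotv x x = 1 -> phi (U *m x) = (support_mx X s n *m D) *m f x + c.
  by move=> x1; rewrite (support_mxE sz us aX supp x1) sD // mulmxA.
have [|V [B [VV posB E]]] := polar_normal_form full UU cc phiE.
  by move=> x x1; rewrite dotvE -!mulmxA mulmxA (support_mx_orth s n aX) mul0mx mxE.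
by exists U, V, B.
Qed.

End Support.

(** * Zero sets of [p a + q b] *)

Section Patterns.
Variable R : realType.
Implicit Types p q : 'I_3 -> R.

(* Positions 0 to 5 belong to phi_8, phi_7, phi_6, phi_5, phi_4 and phi_2. *)
Definition supports : seq (seq ('I_3 * 'I_3)) :=
  [:: [:: (0, 0); (0, 1); (0, 2); (1, 0); (1, 1); (1, 2); (2, 0); (2, 1); (2, 2)];
      [:: (0, 1); (0, 2); (1, 0); (1, 1); (1, 2); (2, 0); (2, 1); (2, 2)];
      [:: (0, 0); (0, 1); (0, 2); (1, 1); (1, 2); (2, 1); (2, 2)];
      [:: (0, 1); (0, 2); (1, 1); (1, 2); (2, 1); (2, 2)];
      [:: (0, 0); (0, 1); (0, 2); (1, 0); (2, 0)];
      [:: (0, 0); (1, 0); (2, 0)];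
      [::]].

Lemma supported_onP p q (s : seq ('I_3 * 'I_3)) :
  (forall a b, if (a, b) \in s then is_true (0 < p a + q b) else p a + q b = 0) ->
  supported_on p q s.
Proof. by move=> h a b; have := h a b; case: ((a, b) \in s). Qed.

Lemma min_pattern_support p q : min_pattern p -> min_pattern q ->
  (forall a b, 0 <= p a + q b) ->
  exists2 i, (i < 7)%N & supported_on p q (nth [::] supports i) \/
                         supported_on q p (nth [::] supports i).
Proof.
move=> pp pq nn.
have pr (i : nat) : (i < 7)%N -> supported_on p q (nth [::] supports i) ->
  exists2 i, (i < 7)%N & supported_on p q (nth [::] supports i) \/
                         supported_on q p (nth [::] supports i).
  by move=> i7 h; exists i => //; left.
have pl (i : nat) : (i < 7)%N -> supported_on q p (nth [::] supports i) ->
  exists2 i, (i < 7)%N & supported_on p q (nth [::] supports i) \/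
                         supported_on q p (nth [::] supports i).
  by move=> i7 h; exists i => //; right.
have [z|z] := pselect (exists a b, p a + q b = 0); last first.
  apply: (pr 0%N) => //; apply: supported_onP => a b.
  have -> : (a, b) \in nth [::] supports 0.
    by move: a b; apply: ord3_case; apply: ord3_case.
  have ab : p a + q b != 0 by apply/eqP => ab; apply: z; exists a, b.
  rewrite lt_def ab /=.
  by move: a b {ab}; apply: ord3_case; apply: ord3_case.
(* The sum at two minima is at most the value 0 attained at some position, and it is nonnegative. *)
have zmin a b : (forall a', p a <= p a') -> (forall b', q b <= q b') -> p a + q b = 0.
  move: z => [a' [b' ab]] pa qb; apply/eqP.
  by rewrite eq_le nn andbT -ab lerD.
(* Rectangles of shapes 1x2, 1x3 and 2x3 occur in two orientations; the one that is not listed is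
   handled by exchanging [p] and [q] ([pl]). *)
clear z; move: pp pq => -[[p1 p2]|[p1 p2]|[p1 p2]] [[q1 q2]|[q1 q2]|[q1 q2]].
- have z0 : p 0 + q 0 = 0 by apply: zmin; apply: ord3_case; lra.
  apply: (pr 1%N) => //; apply: supported_onP.
  by apply: ord3_case; apply: ord3_case => /=; lra.
- have z0 : p 0 + q 1 = 0 by apply: zmin; apply: ord3_case; lra.
  apply: (pl 2%N) => //; apply: supported_onP.
  by apply: ord3_case; apply: ord3_case => /=; lra.
- have z0 : p 0 + q 0 = 0 by apply: zmin; apply: ord3_case; lra.
  apply: (pl 3%N) => //; apply: supported_onP.
  by apply: ord3_case; apply: ord3_case => /=; lra.
- have z0 : p 1 + q 0 = 0 by apply: zmin; apply: ord3_case; lra.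
  apply: (pr 2%N) => //; apply: supported_onP.
  by apply: ord3_case; apply: ord3_case => /=; lra.
- have z0 : p 1 + q 1 = 0 by apply: zmin; apply: ord3_case; lra.
  apply: (pr 4%N) => //; apply: supported_onP.
  by apply: ord3_case; apply: ord3_case => /=; lra.
- have z0 : p 1 + q 1 = 0 by apply: zmin; apply: ord3_case; lra.
  apply: (pl 5%N) => //; apply: supported_onP.
  by apply: ord3_case; apply: ord3_case => /=; lra.
- have z0 : p 0 + q 0 = 0 by apply: zmin; apply: ord3_case; lra.
  apply: (pr 3%N) => //; apply: supported_onP.
  by apply: ord3_case; apply: ord3_case => /=; lra.
- have z0 : p 1 + q 1 = 0 by apply: zmin; apply: ord3_case; lra.
  apply: (pr 5%N) => //; apply: supported_onP.
  by apply: ord3_case; apply: ord3_case => /=; lra.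
- have z0 : p 0 + q 0 = 0 by apply: zmin; apply: ord3_case; lra.
  apply: (pr 6%N) => //; apply: supported_onP.
  by apply: ord3_case; apply: ord3_case => /=; lra.
Qed.

End Patterns.

(** * The model maps span the entries of [qrot] on each support *)

Section Models.
Variable R : realType.
Local Notation r2 := (Num.sqrt (2 : R)).
Local Notation r3 := (Num.sqrt (3 : R)).
Implicit Type x : 'cV[R]_4.

Lemma crdE x : (crd x 0 = x 0 0) * (crd x 1 = x 1 0) * (crd x 2 = x 2 0) * (crd x 3 = x 3 0).
Proof. by rewrite /crd; do !split; congr (x _ 0); apply: val_inj; rewrite /= inordK. Qed.

Let r2_neq0 : r2 != 0. Proof. by rewrite gt_eqF // sqrtr_gt0. Qed.
Let r3_neq0 : r3 != 0. Proof. by rewrite gt_eqF // sqrtr_gt0. Qed.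

(** Here (x1, x2, x3, x4) are the quaternion coordinates. Rows follow the order of the support, and
    [2 / r2] converts the factor [r2] of the model into the factor 2 of [qrot]. *)
Lemma support_phi7 x : support_vec (nth [::] supports 1) 8 x = mx_of 8 8
  [:: [:: 0; 0; 0; 0; - (2 / r2); 2 / r2; 0; 0];
      [:: 0; 0; 0; 2 / r2; 0; 0; 2 / r2; 0];
      [:: 0; 0; 0; 0; 2 / r2; 2 / r2; 0; 0];
      [:: 1; 1; 0; 0; 0; 0; 0; 0];
      [:: 0; 0; -1; 0; 0; 0; 0; 1];
      [:: 0; 0; 0; - (2 / r2); 0; 0; 2 / r2; 0];
      [:: 0; 0; 1; 0; 0; 0; 0; 1];
      [:: 1; -1; 0; 0; 0; 0; 0; 0]] *m phi7 x.
Proof.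
apply/matrixP => i j; rewrite (ord1 j) /phi7 !crdE.
case: i => -[|[|[|[|[|[|[|[|//]]]]]]]] ?;
  by rewrite [LHS]mxE /= !mxE !big_ord_recr big_ord0 /= !mxE /=; field.
Qed.

Lemma support_phi6 x : support_vec (nth [::] supports 2) 7 x = mx_of 7 7
  [:: [:: r2; 0; 0; 0; 0; 0; 0];
      [:: 0; 0; 0; 0; 0; 2 / r3; 0];
      [:: 0; 0; 0; 0; 2 / r3; 0; 0];
      [:: 0; r2; r2; 0; 0; 0; 0];
      [:: 0; 0; 0; - (2 / r2); 0; 0; 2 / r2];
      [:: 0; 0; 0; 2 / r2; 0; 0; 2 / r2];
      [:: 0; r2; - r2; 0; 0; 0; 0]] *m phi6 x.
Proof.
apply/matrixP => i j; rewrite (ord1 j) /phi6 !crdE.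
case: i => -[|[|[|[|[|[|[|//]]]]]]] ?;
  by rewrite [LHS]mxE /= !mxE !big_ord_recr big_ord0 /= !mxE /=; field; rewrite ?r3_neq0 ?r2_neq0.
Qed.

Lemma support_phi5 x : support_vec (nth [::] supports 3) 6 x = mx_of 6 6
  [:: [:: 0; 0; 0; 0; 2 / r2; 0];
      [:: 0; 0; 0; 2 / r2; 0; 0];
      [:: 1; 1; 0; 0; 0; 0];
      [:: 0; 0; -1; 0; 0; 1];
      [:: 0; 0; 1; 0; 0; 1];
      [:: 1; -1; 0; 0; 0; 0]] *m phi5 x.
Proof.
apply/matrixP => i j; rewrite (ord1 j) /phi5 !crdE.
case: i => -[|[|[|[|[|[|//]]]]]] ?;
  by rewrite [LHS]mxE /= !mxE !big_ord_recr big_ord0 /= !mxE /=; field.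
Qed.

Lemma support_phi4 x : support_vec (nth [::] supports 4) 5 x = mx_of 5 5
  [:: [:: 1; 0; 0; 0; 0];
      [:: 0; 0; -1; 1; 0];
      [:: 0; 1; 0; 0; 1];
      [:: 0; 0; 1; 1; 0];
      [:: 0; -1; 0; 0; 1]] *m phi4 x.
Proof.
apply/matrixP => i j; rewrite (ord1 j) /phi4 !crdE.
case: i => -[|[|[|[|[|//]]]]] ?;
  by rewrite [LHS]mxE /= !mxE !big_ord_recr big_ord0 /= !mxE /=; ring.
Qed.

Lemma support_phi2 x : support_vec (nth [::] supports 5) 3 x = mx_of 3 3
  [:: [:: 1; 0; 0]; [:: 0; 0; 1]; [:: 0; -1; 0]] *m phi2 x.
Proof.
apply/matrixP => i j; rewrite (ord1 j) /phi2 !crdE.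
case: i => -[|[|[|//]]] ?;
  by rewrite [LHS]mxE /= !mxE !big_ord_recr big_ord0 /= !mxE /=; ring.
Qed.

Lemma support_standard (f : 'cV[R]_4 -> 'cV[R]_9) : standard_minimal_immersion f ->
  exists D : 'M[R]_9, forall x, dotv x x = 1 ->
    support_vec (nth [::] supports 0) 9 x = D *m f x.
Proof.
move=> [_ _ [span _] _ _].
have /choice[d dE] (i : 'I_9) : exists d : 'cV[R]_9, forall x, x \in usphere R 4 ->
    support_vec (nth [::] supports 0) 9 x i 0 = dotv d (f x).
  have [d dE] := span _ (qrot_harmonic R (nth (0, 0) (nth [::] supports 0) i).1
    (nth (0, 0) (nth [::] supports 0) i).2).
  by exists d => x /dE <-; rewrite mxE.
exists (\matrix_(i, j) d i j 0) => x /usphereP x1.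
apply/matrixP => i j; rewrite (ord1 j) dE // mxE.
by apply: eq_bigr => k _; rewrite mxE.
Qed.

End Models.

(** * Conclusion of the classification *)

Lemma adapted_exists (R : realType) (n : nat) (phi : 'cV[R]_4 -> 'cV[R]_(n + 1)) :
  quadratic_form phi -> proper_biharmonic phi ->
  exists (c : 'cV[R]_(n + 1)) U X p q i,
    [/\ dotv c c = 2^-1, adapted phi c U X p q, (i < 7)%N
      & supported_on p q (nth [::] supports i)].
Proof.
move=> qf pb; have [A [c [symA trA cc cA [Anorm phiE]]]] := proper_biharmonic_structure qf pb.
have /choice[X XE] (k : 'I_(n + 1)) : exists X : 'M[R]_3,
    forall x, dotv x (A k *m x) = mxdot X (qrot x).
  exact: traceless_qrot.
have bilX x : bil A x x = \col_k mxdot (X k) (qrot x).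
  by apply/matrixP => k j; rewrite !mxE XE.
have iso : isotropic X 2^-1.
  move=> x; rewrite -Anorm bilX; apply: eq_bigr => k _.
  by rewrite mxE -expr2.
have cX : \sum_k c k 0 *: X k = 0.
  apply: qrot_separates => x; rewrite -(cA x) bilX /mxdot raddf_sum /= mulmx_suml raddf_sum.
  by apply: eq_bigr => k _; rewrite /= linearZ /= -scalemxAl mxtraceZ mxE.
have [r [s [p [q [r1 s1 gY pp pq]]]]] := canonical_frame iso.
set Y := fun k => _ in gY.
have aY : adapted phi c (left_mul r *m right_mul s) Y p q.
  split=> //.
  - by apply: orthogonal_mxM; [exact: left_mul_orthogonal|exact: right_mul_orthogonal].
  - move=> x x1; rewrite -mulmxA phiE; last first.
      by rewrite !orthogonal_dotv //; [exact: right_mul_orthogonal|exact: left_mul_orthogonal].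
    rewrite bilX; congr (_ + _); apply/matrixP => k j.
    by rewrite !mxE /Y mxdot_mulmx qrot_left_mul qrot_right_mul mulmxA.
  - transitivity ((qrot r)^T *m (\sum_k c k 0 *: X k) *m (qrot s)^T).
      rewrite mulmx_sumr mulmx_suml; apply: eq_bigr => k _.
      by rewrite -scalemxAr -scalemxAl.
    by rewrite cX mulmx0 mul0mx.
have nn a b : 0 <= p a + q b.
  have := gY a b a b; rewrite !eqxx !mulr1 => <-.
  by apply: sumr_ge0 => k _; rewrite -expr2 sqr_ge0.
have [i i7 [sp|sp]] := min_pattern_support pp pq nn.
  by exists c, (left_mul r *m right_mul s), Y, p, q, i.
(* The rectangle has the transposed orientation: conjugation exchanges the roles of [p] and [q]. *)
exists c, ((left_mul r *m right_mul s) *m conj_mx R), (fun k => (Y k)^T), q, p, i.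
by split=> //; exact: adapted_tr.
Qed.

Theorem theorem3p9 (R : realType) (n : nat)
    (phi : 'cV[R]_4 -> 'cV[R]_(n + 1)) :
  quadratic_form phi -> full_map phi -> proper_biharmonic phi ->
  [/\ (3 <= n)%N, (n <= 9)%N, n <> 4%N
    & forall f : 'cV[R]_4 -> 'cV[R]_n, is_phi_pred f ->
      exists (U : 'M[R]_4) (V : 'M[R]_(n + 1)) (B : 'M[R]_n),
        [/\ orthogonal_mx U, orthogonal_mx V, sympos_mx B
          & forall x, x \in usphere R 4 ->
              V *m phi (U *m x) =
              col_mx ((Num.sqrt 2)^-1 *: (B *m f x))
                     (const_mx (Num.sqrt 2)^-1)]].
Proof.
move=> qf full pb.
have [c [U [X [p [q [i [cc aX i7 sp]]]]]]] := adapted_exists qf pb.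
have us : uniq (nth [::] supports i) by move: i i7 {sp}; do 7?[case=> //].
have nE := support_size (erefl _) us aX sp full cc.
have nf := normal_form_of_support (esym nE) us aX sp full cc.
(* An empty support leaves only the constant [c], which the definition of a quadratic form
   excludes. *)
have i6 : i <> 6.
  move=> i6; have [_ [x [y [/usphereP x1 /usphereP y1 /eqP]]]] := qf; apply.
  have phic z : dotv z z = 1 -> phi z = c.
    move=> z1; have [UU _ _ _] := aX.
    have -> : z = U *m (U^T *m z) by rewrite mulmxA UU mul1mx.
    rewrite (support_mxE (erefl _) us aX sp); last first.
      by rewrite orthogonal_dotv //; exact: orthogonal_mx_tr.
    rewrite -[RHS]add0r; congr (_ + _); apply/matrixP => k j; rewrite [RHS]mxE mxE.
    by rewrite big1 // => l _; have := ltn_ord l; rewrite {2}i6.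
  by rewrite !phic.
(* The sizes of the remaining supports are 9, 8, 7, 6, 5 and 3, which gives the bounds and omits
   4. *)
case: i i7 i6 sp us nE nf => [|[|[|[|[|[|[|//]]]]]]] _ i6 _ _ /= nE; subst n => nf //; split=> // f.
- move=> /support_standard[D DE]; exact: (nf D f DE).
- by move=> ->; apply: nf => x _; exact: support_phi7.
- by move=> ->; apply: nf => x _; exact: support_phi6.
- by move=> ->; apply: nf => x _; exact: support_phi5.
- by move=> ->; apply: nf => x _; exact: support_phi4.
- by move=> ->; apply: nf => x _; exact: support_phi2.
Qed.
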